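(* Let $\rho(r)$ be an arbitrary proximate order, $\mu\in\mathfrak M_\infty(\rho(r))$, and let $K$ be a function on $(0,\infty)$ with support contained in some segment $[a,b]\subset(0,\infty)$, continuous everywhere except at the point $t=1$, which is a discontinuity of the first kind of $K$, and such that $K$ is left-continuous at $t=1$. Put $$J(r)=\frac1{V(r)}\int_0^\infty K\left(\frac tr\right)d\mu(t).$$ Then $$L(J,\infty)=\left\{\int_{(0,1]}K(t)\,d\nu_1(t)+\int_{[1,\infty)}\widetilde K(t)\,d\nu_2(t):\ (\nu_1,\nu_2)\in\widehat{Fr}[\mu]\right\},$$ where $\widetilde K$ is the continuous extension of $K$ from $(1,\infty)$ to $[1,\infty)$.
   Context: Proximate orders: a zero proximate order is a real function $\hat\rho(r)$ on $(0,\infty)$ (possibly undefined at $r=1$) such that $\lim_{r\to\infty}\hat\rho(r)=0$; $\hat\rho(1/r)=-\hat\rho(r)$; $\hat\rho$ is continuously differentiable on $(0,\infty)\setminus\{1\}$; $\lim_{r\to\infty}r\ln r\,\hat\rho'(r)=0$; and $r^{\hat\rho(r)}$ extends continuously to $r=1$ with value $1$. A proximate order is $\rho(r)=\rho+\hat\rho(r)$ with $\rho\in\mathbb R$ and $\hat\rho$ a zero proximate order. Put $V(r)=r^{\rho(r)}$. Radon measures: a real Radon measure on $(0,\infty)$ is $\mu=\mu_1-\mu_2$ with $\mu_1,\mu_2$ mutually singular positive Borel measures, finite on compact subsets of $(0,\infty)$; a complex Radon measure is $\mu_1+i\mu_2$ with $\mu_1,\mu_2$ real Radon measures; $|\mu|$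 is the total variation. Wide convergence $\mu_n\to\mu$ means $\int\varphi\,d\mu_n\to\int\varphi\,d\mu$ for every continuous $\varphi$ with compact support in $(0,\infty)$. $\mathfrak M_\infty(\rho(r))$ is the set of Radon measures on $(0,\infty)$ with $\sup_{r\ge1}|\mu|([r,er])/V(r)<\infty$. Put $\mu_t(E)=\mu(tE)/V(t)$. The extended limit set $\widehat{Fr}[\mu]$ is the set of pairs $(\nu_1,\nu_2)$ of Radon measures for which there is a sequence $r_n\to\infty$ such that $\mu_{r_n}\to\nu$ (for some $\nu$), $\mu^1_{r_n}\to\nu_1$, $\mu^2_{r_n}\to\nu_2$ widely, where $\mu^1_{r_n}$ is the restriction of $\mu_{r_n}$ to $(0,1]$ and $\mu^2_{r_n}$ is the restriction of $\mu_{r_n}$ to $(1,\infty)$ (both regarded as measures on $(0,\infty)$). $L(f,\infty)$ denotes the set of all limits (finite or infinite) $\lim_{n\to\infty}f(r_n)$ with $r_n\to\infty$. *)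

(* Defs.v *)
From HB Require Import structures.
From mathcomp Require Import all_boot all_order all_algebra.
From mathcomp Require Import complex.
From mathcomp Require Import all_classical all_reals all_analysis.
From mathcomp Require Import measurable_realfun.

Set Implicit Arguments.
Unset Strict Implicit.
Unset Printing Implicit Defensive.

Import Order.TTheory GRing.Theory Num.Theory.
Import numFieldNormedType.Exports.

Local Open Scope classical_set_scope.
Local Open Scope ring_scope.

(* Functions on (0, +oo) are represented by total functions on R whose values
   outside (0, +oo) are never constrained nor used. *)

(* [^o] endows R[i] with its normed topology. *)
Notation cplx R := (complex R)^o.

Section proximate_order.
Context {R : realType}.
Implicit Types rho h : R -> R.

(* The value [h 1] is left unconstrained ([1 `^ x = 1] for every [x]). *)
Definition zero_proximate_order h : Prop :=
  [/\ h r @[r --> +oo] --> (0 : R),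
      forall r, 0 < r -> r != 1 -> h (1 / r) = - h r,
      forall r, 0 < r -> r != 1 ->
        derivable h r 1 /\ {for r, continuous (derive1 h)},
      r * ln r * derive1 h r @[r --> +oo] --> (0 : R)
    & r `^ h r @[r --> (1 : R)^'] --> (1 : R)].

Definition proximate_order rho : Prop :=
  exists (rho0 : R) (h : R -> R),
    zero_proximate_order h /\ rho = (fun r => rho0 + h r).

Definition Vfun rho (r : R) : R := r `^ rho r.

Lemma Vfun_inv_ge0 rho r : 0 <= (Vfun rho r)^-1.
Proof. by rewrite invr_ge0 powR_ge0. Qed.

End proximate_order.

Section radon.
Context {R : realType}.

(* A Borel measure on (0, +oo) is a Borel measure on R that does not charge
   (-oo, 0]. *)
Record pos_radon := PosRadon {
  pos_radon_measure :> {measure set R -> \bar R} ;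
  pos_radon_null : pos_radon_measure `]-oo, 0]%classic = 0%E ;
  pos_radon_fin : forall Q : set R, compact Q -> Q `<=` `]0, +oo[ ->
    (pos_radon_measure Q < +oo)%E }.

Definition mutually_singular (m1 m2 : {measure set R -> \bar R}) : Prop :=
  exists A : set R, [/\ measurable A, m1 A = 0%E & m2 (~` A) = 0%E].

Record real_radon := RealRadon {
  rad_pos : pos_radon ;
  rad_neg : pos_radon ;
  rad_singular : mutually_singular rad_pos rad_neg }.

Record radon := Radon { rad_re : real_radon ; rad_im : real_radon }.

Implicit Types (mu nu : radon) (A D : set R) (f : R -> cplx R).

Definition rel_compact A : Prop :=
  exists Q : set R, [/\ compact Q, Q `<=` `]0, +oo[ & A `<=` Q].

Definition real_radon_val (m : real_radon) A : R :=
  fine (rad_pos m A) - fine (rad_neg m A).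

(* mu(A), meaningful for relatively compact Borel sets A of (0, +oo) *)
Definition radon_val mu A : cplx R :=
  (real_radon_val (rad_re mu) A +i* real_radon_val (rad_im mu) A)%C.

(* The total variation |mu|(A). Pieces are relatively compact because mu is
   only defined on such sets; as (0, +oo) is sigma-compact, every Borel set
   admits such partitions. *)
Definition radon_variation mu A : \bar R :=
  ereal_sup [set (\sum_(0 <= k <oo) (Normc.normc (radon_val mu (F k)))%:E)%E
            | F in [set F : nat -> set R |
                [/\ forall k, measurable (F k), forall k, rel_compact (F k),
                    trivIset setT F & \bigcup_k F k = A]]].

Definition integral_real_radon (m : real_radon) D f : cplx R :=
  ((Rintegral (rad_pos m) D (fun t => complex.Re (f t))
    - Rintegral (rad_neg m) D (fun t => complex.Re (f t)))
   +i* (Rintegral (rad_pos m) D (fun t => complex.Im (f t))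
    - Rintegral (rad_neg m) D (fun t => complex.Im (f t))))%C.

Definition integral_radon mu D f : cplx R :=
  integral_real_radon (rad_re mu) D f
  + 'i%C * integral_real_radon (rad_im mu) D f.

Definition fun_support f : set R := closure [set t | 0 < t /\ f t != 0].

Definition test_function f : Prop :=
  [/\ forall t, 0 < t -> {for t, continuous f},
      compact (fun_support f) & fun_support f `<=` `]0, +oo[].

Definition wide_cvg (mu_ : nat -> radon) nu : Prop :=
  forall phi : R -> cplx R, test_function phi ->
    integral_radon (mu_ n) `]0, +oo[ phi @[n --> \oo]
      --> integral_radon nu `]0, +oo[ phi.

End radon.
Arguments pos_radon : clear implicits.
Arguments real_radon : clear implicits.
Arguments radon : clear implicits.

Section restriction.
Context {R : realType} (D : set R) (mD : measurable D).

Section pos.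
Variable m : pos_radon R.

Lemma restr_le (E : set R) : measurable E -> (mrestr m mD E <= m E)%E.
Proof.
by move=> mE; apply: le_measure; rewrite ?inE//; exact: measurableI.
Qed.

Lemma restr_null : mrestr m mD `]-oo, 0]%classic = 0%E.
Proof.
by apply/eqP; rewrite -measure_le0 -(pos_radon_null m); exact: restr_le.
Qed.

Lemma restr_fin (Q : set R) : compact Q -> Q `<=` `]0, +oo[ ->
  (mrestr m mD Q < +oo)%E.
Proof.
move=> cQ Qp; apply: le_lt_trans (pos_radon_fin m cQ Qp).
by apply: restr_le; apply: closed_measurable; exact: compact_closed.
Qed.

Definition pos_radon_restr : pos_radon R := PosRadon restr_null restr_fin.
End pos.

Lemma restr_singular (m : real_radon R) :
  mutually_singular (pos_radon_restr (rad_pos m)) (pos_radon_restr (rad_neg m)).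
Proof.
have [A [mA pA nA]] := rad_singular m.
exists A; split => //; apply/eqP; rewrite -measure_le0.
- by rewrite -pA; apply: le_measure; rewrite ?inE//; exact: measurableI.
- by rewrite -nA; apply: le_measure; rewrite ?inE//;
    [apply: measurableI => //|]; exact: measurableC.
Qed.

Definition real_radon_restr (m : real_radon R) : real_radon R :=
  RealRadon (restr_singular m).

Definition radon_restr (mu : radon R) : radon R :=
  Radon (real_radon_restr (rad_re mu)) (real_radon_restr (rad_im mu)).
End restriction.

Section dilation.
Context {R : realType} (rho : R -> R) (t : {posnum R}).

(* The preimage of E under [shrink] is t E. *)
Definition shrink (s : R) : R := s / t%:num.

Lemma measurable_shrink : measurable_fun [set: R] shrink.
Proof. exact: mulrr_measurable. Qed.

Section pos.
Variable m : pos_radon R.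

Definition dilated : set R -> \bar R := pushforward m shrink.

Lemma dilated0 : dilated set0 = 0%E.
Proof. by rewrite /dilated /pushforward preimage_set0 measure0. Qed.

Lemma dilated_ge0 A : (0 <= dilated A)%E.
Proof. by rewrite /dilated /pushforward; exact: measure_ge0. Qed.

Lemma dilated_sigma_additive : semi_sigma_additive dilated.
Proof.
exact: (@measure_semi_sigma_additive _ _ _
  (measure_function_pushforward__canonical__measure_function_Measure m
     measurable_shrink)).
Qed.

HB.instance Definition _ := isMeasure.Build _ _ _ dilated
  dilated0 dilated_ge0 dilated_sigma_additive.

Definition mdil : {measure set R -> \bar R} :=
  mscale (NngNum (Vfun_inv_ge0 rho t%:num)) dilated.

Lemma mdilE A :
  mdil A = (((Vfun rho t%:num)^-1)%:E * m (shrink @^-1` A))%E.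
Proof. by []. Qed.

Lemma dil_null : mdil `]-oo, 0]%classic = 0%E.
Proof.
rewrite mdilE (_ : _ @^-1` _ = `]-oo, 0]%classic) ?pos_radon_null ?mule0//.
by apply/seteqP; split => s /=; rewrite !in_itv/= pmulr_lle0 ?invr_gt0.
Qed.

Lemma dil_fin (Q : set R) : compact Q -> Q `<=` `]0, +oo[ -> (mdil Q < +oo)%E.
Proof.
move=> cQ Qp; rewrite mdilE.
apply: lte_mul_pinfty => //; first by rewrite lee_fin Vfun_inv_ge0.
rewrite (_ : _ @^-1` _ = (fun s => s * t%:num) @` Q); last first.
  apply/seteqP; split => [s /= Qs|_ [s Qs <-]/=]; last by rewrite /shrink mulfK.
  by exists (shrink s) => //; rewrite /shrink divfK.
apply: pos_radon_fin.
- apply: continuous_compact => //; apply: continuous_subspaceT => s.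
  exact: mulrr_continuous.
- move=> _ [s /Qp/= + <-]; rewrite !in_itv/= !andbT => s0.
  by rewrite mulr_gt0.
Qed.

Definition pos_radon_dil : pos_radon R := PosRadon dil_null dil_fin.

Lemma pos_radon_dilE A :
  pos_radon_dil A = (((Vfun rho t%:num)^-1)%:E * m (shrink @^-1` A))%E.
Proof. by []. Qed.
End pos.

Lemma dil_singular (m : real_radon R) :
  mutually_singular (pos_radon_dil (rad_pos m)) (pos_radon_dil (rad_neg m)).
Proof.
have [A [mA pA nA]] := rad_singular m.
have mm : measurable_fun [set: R] (fun s : R => s * t%:num).
  exact: mulrr_measurable.
have E (B : set R) : shrink @^-1` ((fun s => s * t%:num) @^-1` B) = B.
  by apply/seteqP; split => s /=; rewrite /shrink divfK.
exists ((fun s => s * t%:num) @^-1` A); split.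
- by rewrite -[X in measurable X]setTI; exact: mm.
- by rewrite pos_radon_dilE E pA mule0.
- by rewrite pos_radon_dilE -preimage_setC E nA mule0.
Qed.

Definition real_radon_dil (m : real_radon R) : real_radon R :=
  RealRadon (dil_singular m).

(* mu_t(E) = mu(t E) / V(t) *)
Definition radon_dil (mu : radon R) : radon R :=
  Radon (real_radon_dil (rad_re mu)) (real_radon_dil (rad_im mu)).
End dilation.

Section limit_sets.
Context {R : realType}.

Definition M_infty (rho : R -> R) : set (radon R) :=
  [set mu | (ereal_sup [set (radon_variation mu `[r, (expR 1 * r)%R]%classic
                             * ((Vfun rho r)^-1)%:E)%E
                       | r in [set r : R | (1 <= r)%R]] < +oo)%E].

Definition Fr_hat (rho : R -> R) (mu : radon R) : set (radon R * radon R) :=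
  [set nu | exists2 r : nat -> {posnum R},
      (r n)%:num @[n --> \oo] --> +oo &
      exists nu0 : radon R,
      [/\ wide_cvg (fun n => radon_dil rho (r n) mu) nu0,
          wide_cvg (fun n => radon_restr (measurable_itv `]0, 1])
                               (radon_dil rho (r n) mu)) nu.1
        & wide_cvg (fun n => radon_restr (measurable_itv `]1, +oo[)
                               (radon_dil rho (r n) mu)) nu.2]].

(* Finite limits are [Some z]; the infinite limit of a complex-valued function
   is the point [None] at infinity. *)
Definition limit_set (f : R -> cplx R) :
    set (one_point_compactification (cplx R)) :=
  [set z | exists2 r : nat -> {posnum R},
      (r n)%:num @[n --> \oo] --> +oo &
      (Some (f (r n)%:num) : one_point_compactification (cplx R))
        @[n --> \oo] --> z].

Definition first_kind_discontinuity (f : R -> cplx R) (x : R) : Prop :=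
  [/\ cvg (f t @[t --> x^'-]), cvg (f t @[t --> x^'+])
    & ~ {for x, continuous f}].

(* The continuous extension of f from (x, +oo) to [x, +oo). *)
Definition right_extension (f : R -> cplx R) (x t : R) : cplx R :=
  if t == x then lim (f s @[s --> x^'+]) else f t.

End limit_sets.

(* Main.v *)
Require Import Defs.
From HB Require Import structures.
From mathcomp Require Import all_boot all_order all_algebra.
From mathcomp Require Import complex.
From mathcomp Require Import all_classical all_reals all_analysis.
From mathcomp Require Import measurable_realfun ring lra.

(** The kernel K jumps at 1, so wide convergence of the dilations mu_r says
    nothing about J(r), which is the integral of K against mu_r. But K agrees
    on (0, 1] with a continuous function phi1 of compact support, and on
    (1, +oo) with another one, phi2; hence J(r) is the integral of phi1 against
    the restriction of mu_r to (0, 1] plus the integral of phi2 against its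
    restriction to (1, +oo) ([signed_int_split]). If both restrictions converge
    widely along r_n, to nu1 and nu2, then J(r_n) tends to the sum of the
    integrals of phi1 and phi2 against nu1 and nu2. These limits do not charge
    (1, +oo) and (0, 1) respectively ([restricted_limit_null]), so that phi1 may
    be replaced by K on (0, 1] and phi2 by the continuous extension of K on
    [1, +oo). This is [J_cvg]; it gives the inclusion from right to left.

    For the other inclusion, a sequence with J(r_n) tending to z has to be
    thinned out so that mu_(r_n) and its two restrictions converge widely;
    [J_cvg] then identifies z. Three facts make this possible.

    - The measures mu_r are bounded on every compact subset of (0, +oo),
      uniformly for large r ([dil_locally_bounded]). The hypothesis on mu bounds
      the total variation on [r, er] by a multiple of V(r); and V(cr) is at most
      a constant times V(r) because the logarithmic derivative of V is O(1/r)
      ([Vfun_comparable]).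

    - A locally bounded sequence of positive measures has a widely convergent
      subsequence ([helly_selection]). The cumulative functions, written in the
      variable ln t, converge at the rationals along a subsequence, and the
      limit is the Stieltjes measure of the right-continuous regularization of
      the limit function.

    - The limits of the positive and negative parts need not be mutually
      singular, so their difference has to be decomposed anew
      ([jordan_radon]).

    Mutual singularity is also what makes a real measure determined, part by
    part, by its integrals of test functions ([null_oc_of_test]). Finally, z may
    a priori be the point at infinity; uniqueness of limits excludes it, as the
    one-point compactification of the plane is Hausdorff. *)

Set Implicit Arguments.
Unset Strict Implicit.
Unset Printing Implicit Defensive.

Import Order.TTheory GRing.Theory Num.Theory.
Import numFieldNormedType.Exports.

Local Open Scope classical_set_scope.
Local Open Scope ring_scope.

(** * Masses of half-open intervals *)

Section pos_radon_basics.
Context {R : realType}.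
Implicit Types (m : pos_radon R) (f : R -> R).

Lemma pos_radon_itv_fin m (c d : R) : 0 < c -> (m `[c, d]%classic < +oo)%E.
Proof.
move=> c0; apply: pos_radon_fin; first exact: segment_compact.
by move=> t /=; rewrite !in_itv/= => /andP[ct _]; rewrite andbT (lt_le_trans c0).
Qed.

Lemma pos_radon_oc_fin m (c d : R) : 0 < c -> (m `]c, d]%classic < +oo)%E.
Proof.
move=> c0; apply: le_lt_trans (pos_radon_itv_fin m d c0).
by apply: le_measure; rewrite ?inE//; apply: subset_itv; rewrite bnd_simp.
Qed.

Definition oc_mass m (c d : R) : R := fine (m `]c, d]%classic).

Lemma oc_massE m (c d : R) : 0 < c -> m `]c, d]%classic = (oc_mass m c d)%:E.
Proof. by move=> c0; rewrite fineK// ge0_fin_numE// pos_radon_oc_fin. Qed.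

Lemma oc_mass_ge0 m c d : 0 <= oc_mass m c d.
Proof. exact: fine_ge0. Qed.

Lemma oc_mass_ge m (c d : R) : d <= c -> oc_mass m c d = 0.
Proof. by move=> dc; rewrite /oc_mass set_itv_ge ?measure0// bnd_simp -leNgt. Qed.

Lemma oc_massD m (c d e : R) : 0 < c -> c <= d -> d <= e ->
  oc_mass m c e = oc_mass m c d + oc_mass m d e.
Proof.
move=> c0 cd de; apply: EFin_inj; rewrite EFinD -!oc_massE ?(lt_le_trans c0)//.
rewrite -measureU//.
  by rewrite -itv_bndbnd_setU// !bnd_simp.
apply/seteqP; split => // t [/=]; rewrite !in_itv/= => /andP[_ td] /andP[dt _].
by move: (le_lt_trans td dt); rewrite ltxx.
Qed.

(** The coordinate [u = ln t] spreads (0, +oo) over the whole line, where a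
    right-continuous nondecreasing function always has a Stieltjes measure, even
    when the mass near 0 is infinite. *)
Definition log_cdf m (u : R) : R := oc_mass m 1 (expR u) - oc_mass m (expR u) 1.

Lemma log_cdfB m (u v : R) : u <= v ->
  log_cdf m v - log_cdf m u = oc_mass m (expR u) (expR v).
Proof.
move=> uv; rewrite /log_cdf.
have euv : expR u <= expR v by rewrite ler_expR.
have [v0|v0] := leP (expR v) 1.
  rewrite (oc_mass_ge m v0) (oc_mass_ge m (le_trans euv v0)).
  by rewrite (oc_massD m (expR_gt0 u) euv v0) !add0r; lra.
rewrite (oc_mass_ge m (ltW v0)).
have [u0|u0] := leP (expR u) 1.
  rewrite (oc_mass_ge m u0) (oc_massD m (expR_gt0 u) u0 (ltW v0)); lra.
by rewrite (oc_mass_ge m (ltW u0)) (oc_massD m ltr01 (ltW u0) euv); lra.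
Qed.

Lemma log_cdf_nd m : {homo log_cdf m : u v / u <= v}.
Proof. by move=> u v uv; rewrite -subr_ge0 log_cdfB// oc_mass_ge0. Qed.

End pos_radon_basics.

(** * Helly's selection theorem *)

Section selection.
Context {R : realType}.

Lemma fmap_ultra (T S : Type) (f : T -> S) (F : set_system T) :
  UltraFilter F -> UltraFilter (f @ F).
Proof.
move=> UF; have PF : ProperFilter F by exact: ultra_proper.
split; first exact: fmap_proper_filter.
move=> G GF sfG; apply/seteqP; split => // A GA.
have [//|FnA] := in_ultra_setVsetC (f @^-1` A) UF.
have GnA : G (~` A) by apply: sfG.
by have [x [Ax nAx]] := filter_ex (filterI GA GnA).
Qed.

(** The limits at all points are taken at once along an ultrafilter finer than
    the tails. Finitely many of the resulting conditions hold on a set of that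
    ultrafilter, which meets every tail; choosing a k-th index that meets the
    first k conditions replaces the usual diagonal extraction. *)
Lemma selection_along_countable (F : nat -> R -> R) :
  (forall u, exists M : R, \forall n \near \oo, `|F n u| <= M) ->
  (forall n, {homo F n : u v / u <= v}) ->
  exists (s : nat -> nat) (g : R -> R),
    [/\ s n @[n --> \oo] --> \oo, {homo g : u v / u <= v} &
     forall q : rat, F (s n) (ratr q) @[n --> \oo] --> g (ratr q)].
Proof.
move=> Fb Fnd.
have [U [UU sU]] := ultraFilterLemma (eventually_filter : ProperFilter (\oo : set_system nat)).
have UP : ProperFilter U by exact: ultra_proper.
have gex : forall u, exists l : R, F n u @[n --> U] --> l.
  move=> u; have [M MF] := Fb u.
  have cM : compact `[-M, M] by exact: segment_compact.
  move: cM; rewrite compact_ultra => /(_ (F ^~ u @ U)) [].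
  - exact: fmap_ultra.
  - apply: sU; near=> n => /=.
    by rewrite in_itv/= -ler_norml; near: n.
  - by move=> l [_ lP]; exists l.
have [g gP] := choice gex.
have gnd : {homo g : u v / u <= v}.
  move=> u v uv; apply: ler_cvg_to (gP u) (gP v) _.
  by apply: filterE => n; exact: Fnd.
pose close k n i := forall q : rat, unpickle i = Some q ->
  `|F n (ratr q) - g (ratr q)| < k.+1%:R^-1.
have sex (k : nat) : exists n, (k <= n)%N /\ forall i, (i < k)%N -> close k n i.
  have : \forall n \near U, (k <= n)%N /\ forall i, (i < k)%N -> close k n i.
    apply: filterI; first by apply: sU; exact: nbhs_infty_ge.
    have H i : \forall n \near U, close k n i.
      rewrite /close; case E : (unpickle i) => [q|]; last exact: filterE.
      have /cvgrPdist_lt/(_ k.+1%:R^-1) := gP (ratr q).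
      rewrite invr_gt0 ltr0n => /(_ isT); apply: filterS => n H _ [<-].
      by rewrite distrC.
    have : forall j, \forall n \near U, forall i, (i < j)%N -> close k n i.
      elim => [|j IH]; first exact: filterE.
      apply: filterS2 IH (H j) => n A B i.
      by rewrite ltnS leq_eqVlt => /predU1P[->//|]; exact: A.
    exact.
  by move=> /filter_ex.
have [s sP] := choice sex.
exists s, g; split => //.
  apply/cvgnyPge => A; near=> n; apply: leq_trans (sP n).1; near: n.
  exact: nbhs_infty_ge.
move=> q; apply/cvgrPdist_lt => e e0; near=> n; rewrite distrC.
apply: (@lt_trans _ _ n.+1%:R^-1).
  apply: ((sP n).2 (pickle q) _ q (pickleK q)).
  near: n; exact: nbhs_infty_gt.
near: n; exact: near_infty_natSinv_lt (PosNum e0).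
Unshelve. all: by end_near. Qed.

(** [G] is the right limit of [g]. The two inequalities place [g] between the
    left limits and the values of [G]; the integral of a continuous function
    cannot see more than that. *)
Lemma right_regularization (g : R -> R) : {homo g : u v / u <= v} ->
  exists G : cumulative R R,
    (forall u, g u <= G u) /\ (forall u v, u < v -> G u <= g v).
Proof.
move=> gnd.
pose S u := g @` `]u, +oo[%classic.
pose G u := inf (S u).
have Slb u : lbound (S u) (g u).
  by move=> _ [v + <-]; rewrite /= in_itv/= andbT => uv; apply/gnd/ltW.
have S0 u : S u !=set0 by exists (g (u + 1)), (u + 1) => //=; rewrite in_itv/= andbT ltrDl.
have Sinf u : has_inf (S u) by split => //; exists (g u).
have gG u : g u <= G u by apply: lb_le_inf.
have Gg u v : u < v -> G u <= g v.
  by move=> uv; apply: ge_inf; [case: (Sinf u)|exists v => //=; rewrite in_itv/= uv].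
have Gnd : {homo G : u v / u <= v}.
  move=> u v; rewrite le_eqVlt => /predU1P[->//|uv].
  exact: le_trans (Gg _ _ uv) (gG v).
have Grc : right_continuous G.
  move=> u; apply/cvgrPdist_lt => e e0.
  have [_ [v + <-]] := inf_adherent e0 (Sinf u).
  rewrite /= in_itv/= andbT => uv gv.
  near=> w.
  have uw : u < w by near: w; exact: nbhs_right_gt.
  have wv : w < v by near: w; exact: nbhs_right_lt.
  rewrite distrC ger0_norm ?subr_ge0 ?Gnd ?(ltW uw)//.
  rewrite ltrBlDl (le_lt_trans _ gv)//.
  exact: Gg.
exists (HB.pack_for (cumulative R R) G (isCumulative.Build R _ R G Gnd Grc)).
by split.
Unshelve. all: by end_near. Qed.

End selection.

Lemma compact_sub_itv {R : realType} (Q : set R) :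
  compact Q -> Q `<=` `]0, +oo[ -> exists c d, 0 < c /\ Q `<=` `[c, d].
Proof.
move=> cQ Qp.
have [->|/set0P Q0] := eqVneq Q set0; first by exists 1, 1; split => // t.
have cid : {within Q, continuous (@idfun R)}.
  by apply: continuous_subspaceT => t; apply: cvg_id.
have [c Qc cmin] := compact_EVT_min Q0 cQ cid.
have [d Qd dmax] := compact_EVT_max Q0 cQ cid.
exists c, d; split.
  by move: Qc; rewrite inE => /Qp/=; rewrite in_itv/= andbT.
by move=> t Qt /=; rewrite in_itv/=; apply/andP; split; [exact/cmin/mem_set|exact/dmax/mem_set].
Qed.

Section bounded_compact.
Context {R : realType}.
Implicit Types (m : pos_radon R) (f : R -> R).

(** This class contains the coordinates of the kernel K, which jump at 1, and is
    stable under positive parts and dilations; its members are integrable for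
    every [pos_radon]. *)
Definition bounded_compact f : Prop :=
  measurable_fun (`]0, +oo[%classic : set R) f /\
  exists c d B : R, [/\ 0 < c, forall t : R, 0 < t -> `|f t| <= B &
                    forall t : R, 0 < t -> f t != 0 -> c <= t <= d].

Definition real_test f : Prop :=
  (forall t : R, 0 < t -> {for t, continuous f}) /\
  exists c d : R, 0 < c /\ forall t : R, 0 < t -> f t != 0 -> c <= t <= d.

Lemma real_test_bounded_compact f : real_test f -> bounded_compact f.
Proof.
move=> [cf [c [d [c0 fcd]]]]; split.
  apply: open_continuous_measurable_fun; first exact: interval_open.
  by move=> t; rewrite inE/= in_itv/= andbT; exact: cf.
have cfcd : {within `[c, d], continuous f}.
  apply: continuous_in_subspaceT => t; rewrite inE/= in_itv/= => /andP[ct _].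
  exact/cf/(lt_le_trans c0).
have /compact_bounded[M [Mr MP]] := continuous_compact cfcd (@segment_compact R c d).
exists c, d, (`|M| + 1); split => // t t0.
have [->|ft] := eqVneq (f t) 0; first by rewrite normr0 addr_ge0.
apply: MP; first by rewrite (le_lt_trans (ler_norm M))// ltrDl.
by exists t => //=; rewrite in_itv/=; exact: fcd.
Qed.

Lemma bounded_compact_integrable m f (D : set R) :
  bounded_compact f -> measurable D -> D `<=` `]0, +oo[ ->
  m.-integrable D (EFin \o f).
Proof.
move=> [mf [c [d [B [c0 fB fcd]]]]] mD Dp.
suff H : m.-integrable `]0, +oo[ (EFin \o f) by exact: integrableS H.
apply/integrable_mkcond => //.
have E : (EFin \o f) \_ `]0, +oo[ = (EFin \o f) \_ `[c, d].
  apply/funext => t; rewrite /patch; case: ifPn => [|]; case: ifPn => //=.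
    move=> ncd; rewrite inE/= in_itv/= andbT => t0.
    by have [->//|/(fcd _ t0)] := eqVneq (f t) 0 => cdt; case/negP: ncd; rewrite ?inE/= ?in_itv.
  rewrite inE/= in_itv/= => /andP[/(lt_le_trans c0) t0 _] /negP[].
  by rewrite inE/= in_itv/= t0.
rewrite E; apply/(@integrable_mkcond _ _ _ m `[c, d] (EFin \o f) _).1 => //.
have scd : `[c, d]%classic `<=` `]0, +oo[%classic.
  by move=> t /=; rewrite !in_itv/= andbT => /andP[/(lt_le_trans c0)].
apply: measurable_bounded_integrable => //.
- exact: pos_radon_itv_fin.
- exact: measurable_funS mf.
- exists B; split; first exact: num_real.
  move=> M BM t /= /scd /=; rewrite in_itv/= andbT => t0.
  exact: le_trans (fB _ t0) (ltW BM).
Qed.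

Lemma Rintegral_supp m f (c d : R) :
  bounded_compact f -> 0 < c -> (forall t, 0 < t -> f t != 0 -> c < t <= d) ->
  Rintegral m `]0, +oo[ f = Rintegral m `]c, d] f.
Proof.
move=> bf c0 fcd.
rewrite Rintegral_mkcond [RHS]Rintegral_mkcond; congr Rintegral.
apply/funext => t; rewrite /patch; case: ifPn => [|]; case: ifPn => //=.
  move=> ncd; rewrite inE/= in_itv/= andbT => t0.
  by have [->//|/(fcd _ t0)] := eqVneq (f t) 0 => cdt; case/negP: ncd; rewrite ?inE/= ?in_itv.
rewrite inE/= in_itv/= => /andP[/(lt_trans c0) t0 _] /negP[].
by rewrite inE/= in_itv/= t0.
Qed.

(** The grid depends only on [f] and the error only on the total mass, so one
    grid serves for all the measures of a locally bounded sequence. *)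
Lemma riemann_sum_close m f (x : nat -> R) (J : nat) (e : R) :
  bounded_compact f -> {homo x : i j / (i <= j)%N >-> i <= j} -> 0 < x 0%N ->
  (forall j, (j < J)%N -> forall t, x j < t <= x j.+1 -> `|f t - f (x j)| <= e) ->
  `|Rintegral m `]x 0%N, x J] f - \sum_(j < J) f (x j) * oc_mass m (x j) (x j.+1)|
    <= e * oc_mass m (x 0%N) (x J).
Proof.
move=> bf xnd x0 fx.
have xp j : 0 < x j by apply: lt_le_trans (xnd 0%N j _).
have int a b : 0 < a -> m.-integrable `]a, b] (EFin \o f).
  move=> a0; apply: bounded_compact_integrable => // t /=.
  by rewrite !in_itv/= andbT => /andP[/(lt_trans a0)].
elim: J fx => [|J IH] fx.
  rewrite big_ord0 oc_mass_ge// mulr0 set_itv_ge ?bnd_simp ?ltxx//.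
  by rewrite Rintegral_set0 subr0 normr0.
have IHJ : `|Rintegral m `]x 0%N, x J] f - \sum_(j < J) f (x j) * oc_mass m (x j) (x j.+1)|
    <= e * oc_mass m (x 0%N) (x J).
  by apply: IH => j jJ; apply: fx; rewrite ltnS ltnW.
have step : `|Rintegral m `]x J, x J.+1] f - f (x J) * oc_mass m (x J) (x J.+1)|
   <= e * oc_mass m (x J) (x J.+1).
  rewrite /oc_mass -!Rintegral_cst//.
  have ic k : m.-integrable `]x J, x J.+1] (EFin \o (fun=> k : R)).
    apply: measurable_bounded_integrable => //; first exact: pos_radon_oc_fin.
    by exists `|k|; split; [exact: num_real|move=> M kM t _ /=; exact: ltW].
  rewrite -RintegralB//; last exact: int.
  have iB : m.-integrable `]x J, x J.+1] (EFin \o (fun t => f t - f (x J))).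
    exact: (integrableB _ (int _ _ _) (ic _)).
  apply: le_trans (le_normr_Rintegral _ iB) _ => //.
  apply: le_Rintegral => //; first exact: (integrable_norm iB).
  by move=> t /= /fx; apply.
rewrite (oc_massD m x0 (xnd 0%N J _) (xnd J J.+1 _))// mulrDr.
have -> : `]x 0%N, x J.+1]%classic = `]x 0%N, x J] `|` `]x J, x J.+1].
  by rewrite -itv_bndbnd_setU// bnd_simp xnd.
rewrite Rintegral_setU//; last 2 first.
  - rewrite -itv_bndbnd_setU ?bnd_simp ?xnd//; exact: int.
  - apply/disj_setPS => t [/=]; rewrite !in_itv/= => /andP[_ td] /andP[dt _].
    by move: (le_lt_trans td dt); rewrite ltxx.
rewrite big_ord_recr/= opprD addrACA.
exact: le_trans (ler_normD _ _) (lerD IHJ step).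
Qed.

(** Summation by parts moves the differences from [h] to [psi]. With [h = G - g]
    it shows that passing from [g] to its regularization [G] hardly changes the
    Stieltjes sums of a function of small oscillation, although [g] and [G] may
    differ at the points of the grid. *)
Lemma abel_sum_bound (psi h G : nat -> R) (J : nat) (e : R) :
  psi 0%N = 0 -> psi J = 0 ->
  (forall j, (j < J)%N -> `|psi j.+1 - psi j| <= e) ->
  (forall j, (j < J)%N -> 0 <= h j.+1 <= G j.+1 - G j) ->
  `|\sum_(j < J) psi j * (h j.+1 - h j)| <= e * (G J - G 0%N).
Proof.
move=> psi0 psiJ psie hG.
have -> : \sum_(j < J) psi j * (h j.+1 - h j) =
    - \sum_(j < J) (psi j.+1 - psi j) * h j.+1.
  have : \sum_(j < J) psi j * (h j.+1 - h j) +
      \sum_(j < J) (psi j.+1 - psi j) * h j.+1 = psi J * h J - psi 0%N * h 0%N.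
    rewrite -big_split/= -(telescope_sumr (fun j => psi j * h j))// big_mkord.
    by apply: eq_bigr => j _; ring.
  by rewrite psi0 psiJ; lra.
rewrite normrN; apply: le_trans (ler_norm_sum _ _ _) _.
rewrite -(telescope_sumr G)// big_mkord mulr_sumr.
apply: ler_sum => j _; have /andP[h0 h1] := hG j (ltn_ord j).
rewrite normrM (ger0_norm h0); apply: ler_pM => //.
exact: psie.
Qed.

End bounded_compact.

Section log_stieltjes.
Context {R : realType} (G : cumulative R R).

Definition log_stieltjes : set R -> \bar R :=
  pushforward (lebesgue_stieltjes_measure G) (expR : measurableTypeR R -> R).

Let mexp : measurable_fun [set: measurableTypeR R] (expR : measurableTypeR R -> R).
Proof. exact: measurable_expR. Qed.

Let ls0 : log_stieltjes set0 = 0%E.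
Proof. by rewrite /log_stieltjes /pushforward preimage_set0 measure0. Qed.

Let ls_ge0 A : (0 <= log_stieltjes A)%E.
Proof. by rewrite /log_stieltjes /pushforward; exact: measure_ge0. Qed.

Let ls_sigma : semi_sigma_additive log_stieltjes.
Proof.
exact: (@measure_semi_sigma_additive _ _ _
  (measure_function_pushforward__canonical__measure_function_Measure
     (lebesgue_stieltjes_measure G) mexp)).
Qed.

HB.instance Definition _ := isMeasure.Build _ _ _ log_stieltjes ls0 ls_ge0 ls_sigma.

Lemma log_stieltjes_oc (u v : R) : u <= v ->
  log_stieltjes `]expR u, expR v]%classic = (G v - G u)%:E.
Proof.
move=> uv; rewrite /log_stieltjes /pushforward.
have -> : expR @^-1` `]expR u, expR v] = `]u, v]%classic :> set R.
  by apply/seteqP; split => t /=; rewrite !in_itv/= ltr_expR ler_expR.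
rewrite /lebesgue_stieltjes_measure /measure_extension measurable_mu_extE/=.
  by rewrite wlength_itv_bnd.
exact: is_ocitv.
Qed.

Lemma log_stieltjes_null : log_stieltjes `]-oo, 0]%classic = 0%E.
Proof.
rewrite /log_stieltjes /pushforward (_ : expR @^-1` _ = set0) ?measure0//.
apply/seteqP; split => // t /=; rewrite in_itv/= => h.
by move: (lt_le_trans (expR_gt0 t) h); rewrite ltxx.
Qed.

Lemma log_stieltjes_fin (Q : set R) : compact Q -> Q `<=` `]0, +oo[ ->
  (log_stieltjes Q < +oo)%E.
Proof.
move=> cQ Qp.
have [c [d [c0 Qcd]]] := compact_sub_itv cQ Qp.
have cd : expR (ln (c / 2)) <= expR (Order.max (ln (c / 2)) (ln d)) by rewrite ler_expR le_max lexx.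
apply: (@le_lt_trans _ _ (log_stieltjes `]expR (ln (c / 2)), expR (Order.max (ln (c / 2)) (ln d))])).
  apply: le_measure; rewrite ?inE//; first exact: compact_measurable.
  move=> t /Qcd /=; rewrite !in_itv/= => /andP[ct td].
  have t0 : 0 < t by exact: lt_le_trans ct.
  have d0 : 0 < d by exact: lt_le_trans td.
  rewrite lnK ?posrE; last lra.
  apply/andP; split; first lra.
  by apply: (le_trans td); rewrite -[leLHS]lnK ?posrE// ler_expR le_max lexx orbT.
by rewrite log_stieltjes_oc ?ltry// le_max lexx.
Qed.

Definition log_stieltjes_radon : pos_radon R :=
  PosRadon log_stieltjes_null log_stieltjes_fin.

Lemma log_stieltjes_radonE (u v : R) : u <= v ->
  oc_mass log_stieltjes_radon (expR u) (expR v) = G v - G u.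
Proof. by move=> uv; rewrite /oc_mass /= log_stieltjes_oc. Qed.

End log_stieltjes.

Lemma uniformly_continuous_itv {R : realType} (phi : R -> R) (a b e : R) :
  continuous phi -> 0 < e -> exists2 d : R, 0 < d &
    forall x, a <= x <= b -> forall t, `|t - x| < d -> `|phi t - phi x| < e.
Proof.
move=> cphi e0.
have cab : compact `[a, b] by exact: (@segment_compact R a b).
have /compact_near_coveringP := cab.
pose P (d x : R) := forall t, `|t - x| < d -> `|phi t - phi x| < e.
move=> cov; have H : \forall d \near (0 : R)^'+, `[a, b]%classic `<=` P d.
  apply: cov => x _; have e2 : 0 < e / 2 by lra.
  have /cvgrPdist_lt/(_ _ e2) := cphi x.
  move=> /nbhs_ballP[d /= d0 dP].
  exists (ball x (d / 2), [set d' | 0 < d' < d / 2]).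
    split => /=; first by apply: nbhsx_ballx; lra.
    by near=> d'; apply/andP; split; near: d'; [exact: nbhs_right_gt|apply: nbhs_right_lt; lra].
  move=> [x' d'] /= []; rewrite /ball/= => xx' /andP[d'0 d'd] t tx'.
  have h1 : `|phi x - phi x'| < e / 2 by apply: dP; rewrite /ball/=; apply: (lt_trans xx'); lra.
  have h2 : `|phi x - phi t| < e / 2.
    apply: dP; rewrite /ball/= (_ : x - t = (x - x') - (t - x')); last by ring.
    by apply: (le_lt_trans (ler_normB _ _)); lra.
  rewrite (_ : _ - _ = (phi x - phi x') - (phi x - phi t)); last by ring.
  by apply: (le_lt_trans (ler_normB _ _)); lra.
have /filter_ex[d [d0 dP]] : \forall d \near (0 : R)^'+, 0 < d /\ forall x, `[a, b]%classic x -> P d x.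
  by apply: filterI; [exact: nbhs_right_gt|exact: H].
by exists d => // x xab; apply: dP; rewrite /= in_itv.
Unshelve. all: by end_near. Qed.

Section helly.
Context {R : realType}.

Definition vague_cvg (m_ : nat -> pos_radon R) (l : pos_radon R) : Prop := forall f, real_test f ->
  Rintegral (m_ n) `]0, +oo[ f @[n --> \oo] --> Rintegral l `]0, +oo[ f.

Definition locally_bounded (m_ : nat -> pos_radon R) : Prop := forall c d : R, 0 < c ->
  exists M : R, \forall n \near \oo, (m_ n `[c, d]%classic <= M%:E)%E.

Lemma locally_bounded_comp (p_ : nat -> pos_radon R) (s : nat -> nat) :
  s n @[n --> \oo] --> \oo -> locally_bounded p_ -> locally_bounded (p_ \o s).
Proof.
by move=> soo b c d c0; have [M MP] := b c d c0; exists M; exact: soo MP.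
Qed.

(** Both the integral against [m_ n] and the one against the limit are close to
    Stieltjes sums over a common rational grid ([riemann_sum_close]); the sums
    for [m_ n] converge to that for [g], which is close to that for [G] by
    [abel_sum_bound]. No continuity point of [G] is involved. *)
Lemma vague_cvg_of_cdf (m_ : nat -> pos_radon R) (g : R -> R) (G : cumulative R R) :
  locally_bounded m_ ->
  (forall u, g u <= G u) -> (forall u v, u < v -> G u <= g v) ->
  (forall q : rat, log_cdf (m_ n) (ratr q) @[n --> \oo] --> g (ratr q)) ->
  vague_cvg m_ (log_stieltjes_radon G).
Proof.
move=> mb gG Gg mg f tf.
have bf := real_test_bounded_compact tf.
have [cf [c [d [c0 fcd]]]] := tf.
pose phi := f \o expR.
have cphi : continuous phi.
  move=> u; apply: continuous_comp; first exact: continuous_expR.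
  exact/cf/expR_gt0.
have [N [N0 cN dN]] : exists N : nat,
    [/\ 0 < N%:R :> R, expR (- N%:R) < c & d < expR N%:R :> R].
  have /filter_ex[N] : \forall N \near \oo, `|ln c| + `|ln d| < N%:R := nbhs_infty_gtr _.
  have lc := normr_ge0 (ln c); have ld := normr_ge0 (ln d) => lN; exists N; split.
  - lra.
  - rewrite -[ltRHS]lnK ?posrE// ltr_expR.
    by have := ler_norm (- ln c); rewrite normrN; lra.
  - have [d0|d0] := leP d 0; first exact: le_lt_trans (expR_gt0 _).
    rewrite -[ltLHS]lnK ?posrE// ltr_expR.
    by have := ler_norm (ln d); lra.
set xN := expR N%:R : R in dN; set x0 := expR (- N%:R) : R in cN.
have [M0 M0P] := mb x0 xN (expR_gt0 _).
pose M := `|M0|.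
pose L := G N%:R - G (- N%:R).
have L0 : 0 <= L.
  by rewrite subr_ge0; apply: cumulative_is_nondecreasing; lra.
apply/cvgrPdist_lt => e e0.
(* The total error will be at most [e1 * (M + 2 * L) + e / 2], where M bounds
   the masses of the sequence and L is the mass of the limit. *)
pose C := M + 2 * L + 1.
have M_ge0 : 0 <= M by exact: normr_ge0.
have C0 : 0 < C by rewrite /C; lra.
pose e1 := e / (2 * C).
have e10 : 0 < e1 by rewrite divr_gt0//; lra.
have [del del0 delP] := uniformly_continuous_itv (- N%:R) N%:R cphi e10.
have [k kdel] : exists k : nat, k.+1%:R^-1 < del.
  have /filter_ex[k ?] : \forall k \near \oo, k.+1%:R^-1 < del := near_infty_natSinv_lt (PosNum del0).
  by exists k.
pose q j : rat := j%:R / k.+1%:R - N%:R.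
pose u j : R := ratr (q j).
have uE j : u j = j%:R / k.+1%:R - N%:R.
  by rewrite /u /q rmorphB rmorphM/= fmorphV/= !ratr_nat.
have uS j : u j.+1 = u j + k.+1%:R^-1 by rewrite !uE -natr1; ring.
have und : {homo u : i j / (i <= j)%N >-> i <= j}.
  by move=> i j ij; rewrite !uE lerD2r ler_wpM2r ?invr_ge0// ler_nat.
pose J := (2 * N * k.+1)%N.
have u0 : u 0%N = - N%:R by rewrite uE mul0r sub0r.
have uJ : u J = N%:R by rewrite uE /J natrM mulfK// natrM; ring.
pose x j := expR (u j).
have xnd : {homo x : i j / (i <= j)%N >-> i <= j}.
  by move=> i j ij; rewrite ler_expR und.
have xp j : 0 < x j by exact: expR_gt0.
have x0E : x 0%N = x0 by rewrite /x u0.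
have xJE : x J = xN by rewrite /x uJ.
have fx j : (j < J)%N -> forall t, x j < t <= x j.+1 -> `|f t - f (x j)| <= e1.
  move=> jJ t /andP[xt tx].
  have t0 : 0 < t by exact: lt_trans xt.
  rewrite -(@lnK _ t) ?posrE//; apply/ltW/delP.
    by rewrite -u0 -uJ !und//= ltnW.
  have : u j < ln t by rewrite -ltr_expR lnK ?posrE.
  have : ln t <= u j.+1 by rewrite -ler_expR lnK ?posrE.
  rewrite uS => h1 h2; rewrite ger0_norm ?subr_ge0 ?(ltW h2)//.
  by rewrite ltrBlDl (le_lt_trans h1)// ltrD2l.
have fx0 : f (x 0%N) = 0.
  apply/eqP; apply: contraT => /(fcd (x _) (xp _))/andP[+ _].
  by rewrite x0E leNgt cN.
have fxJ : f (x J) = 0.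
  apply/eqP; apply: contraT => /(fcd (x _) (xp _))/andP[_ +].
  by rewrite xJE leNgt dN.
pose S (F : R -> R) := \sum_(j < J) f (x j) * (F (u j.+1) - F (u j)).
have restr (m : pos_radon R) : Rintegral m `]0, +oo[ f = Rintegral m `]x 0%N, x J] f.
  apply: Rintegral_supp => // t t0 /(fcd _ t0)/andP[ct td].
  by rewrite x0E xJE (lt_le_trans cN)//= (le_trans td)// ltW.
have Smn n : `|Rintegral (m_ n) `]0, +oo[ f - S (log_cdf (m_ n))| <= e1 * oc_mass (m_ n) x0 xN.
  rewrite restr -x0E -xJE /S; under eq_bigr do rewrite log_cdfB ?und//.
  exact: riemann_sum_close.
have SG : `|Rintegral (log_stieltjes_radon G) `]0, +oo[ f - S G| <= e1 * L.
  rewrite restr /L -u0 -uJ -log_stieltjes_radonE ?und// /S.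
  under eq_bigr do rewrite -log_stieltjes_radonE ?und//.
  exact: riemann_sum_close.
have SgG : `|S G - S g| <= e1 * L.
  rewrite /L -u0 -uJ.
  rewrite (_ : S G - S g = \sum_(j < J) f (x j) *
      ((G (u j.+1) - g (u j.+1)) - (G (u j) - g (u j)))); last first.
    by rewrite /S -sumrB; apply: eq_bigr => j _; ring.
  apply: (@abel_sum_bound _ (fun j => f (x j)) (fun j => G (u j) - g (u j))
    (fun j => G (u j))) => // j jJ.
  - by apply: fx => //; rewrite lexx andbT ltr_expR uS ltrDl.
  - rewrite subr_ge0 gG/= lerD2l lerN2; apply: Gg.
    by rewrite uS ltrDl.
have Scvg : S (log_cdf (m_ n)) @[n --> \oo] --> S g.
  rewrite /S; apply: cvg_big => [|j _]; first exact: add_continuous. apply: cvgM; first exact: cvg_cst.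
  by apply: cvgB; exact: mg.
have e2 : 0 < e / 2 by lra.
have /cvgrPdist_lt/(_ _ e2) Sn := Scvg.
near=> n.
have nM : oc_mass (m_ n) x0 xN <= M.
  apply: le_trans (ler_norm M0); rewrite -lee_fin -oc_massE ?expR_gt0//.
  apply: (@le_trans _ _ (m_ n `[x0, xN]%classic)); last by near: n.
  by apply: le_measure; rewrite ?inE//; apply: subset_itv; rewrite bnd_simp.
have Sgn : `|S g - S (log_cdf (m_ n))| < e / 2 by near: n.
have := Smn n.
have eC : e1 * (2 * C) = e by rewrite /e1 divfK// gt_eqF//; lra.
have : e1 * oc_mass (m_ n) x0 xN <= e1 * M by rewrite ler_pM2l.
set I := Rintegral _ _ _ in SG *; set In := Rintegral _ _ _.
move=> h1 h2.
rewrite (_ : I - In = (I - S G) + (S G - S g) + (S g - S (log_cdf (m_ n)))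
  - (In - S (log_cdf (m_ n)))); last by ring.
apply: le_lt_trans (ler_normB _ _) _.
apply: le_lt_trans (lerD (ler_normD _ _) (lexx _)) _.
apply: le_lt_trans (lerD (lerD (ler_normD _ _) (lexx _)) (lexx _)) _.
have : e = 2 * (e1 * M) + 4 * (e1 * L) + 2 * e1 by rewrite -eC /C; ring.
lra.
Unshelve. all: by end_near. Qed.

Theorem helly_selection (m_ : nat -> pos_radon R) : locally_bounded m_ ->
  exists (s : nat -> nat) (l : pos_radon R),
    s n @[n --> \oo] --> \oo /\ vague_cvg (m_ \o s) l.
Proof.
move=> mb.
have Fb u : exists M : R, \forall n \near \oo, `|log_cdf (m_ n) u| <= M.
  pose a : R := Order.min 1 (expR u); pose b : R := Order.max 1 (expR u).
  have a0 : 0 < a by rewrite lt_min ltr01 expR_gt0.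
  have [M MP] := mb a b a0; exists M; near=> n.
  have nM : (m_ n `[a, b]%classic <= M%:E)%E by near: n.
  have H c d : 0 < c -> a <= c -> d <= b -> oc_mass (m_ n) c d <= M.
    move=> c0 ac db; rewrite -lee_fin -oc_massE//; apply: le_trans nM.
    by apply: le_measure; rewrite ?inE//; apply: subset_itv; rewrite bnd_simp.
  rewrite /log_cdf; have [u0|u0] := leP 1 (expR u).
    rewrite (@oc_mass_ge _ _ (expR u) 1)// subr0 ger0_norm ?oc_mass_ge0//.
    by apply: H; rewrite /a /b ?ge_min ?le_max ?lexx ?orbT.
  rewrite (@oc_mass_ge _ _ 1 (expR u) (ltW u0))// sub0r normrN ger0_norm ?oc_mass_ge0//.
  by apply: H; rewrite /a /b ?expR_gt0// ?ge_min ?le_max ?lexx ?orbT.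
have [s [g [soo gnd sg]]] := selection_along_countable Fb (fun n => @log_cdf_nd _ (m_ n)).
have [G [gG Gg]] := right_regularization gnd.
exists s, (log_stieltjes_radon G); split => //.
exact: vague_cvg_of_cdf (locally_bounded_comp soo mb) gG Gg sg.
Unshelve. all: by end_near. Qed.

End helly.

(** * Jordan decomposition of a difference of Radon measures *)

Lemma sube_eq_add {R : realType} (a b x y : \bar R) :
  a \is a fin_num -> b \is a fin_num -> x \is a fin_num -> y \is a fin_num ->
  (a - b = x - y -> x + b = y + a)%E.
Proof.
move: a b x y => [a| |]// [b| |]// [x| |]// [y| |]// _ _ _ _.
move=> /(congr1 fine)/= abxy; rewrite -!EFinD; congr EFin.
by rewrite -(subrK b a) abxy; ring.
Qed.

(** The relation [jp - jn = p - n] on [D] is written without subtraction so that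
    it can be summed over infinitely many sets [D]. *)
Lemma finite_jordan d (T : measurableType d) (R : realType)
    (p n : {measure set T -> \bar R}) (D : set T) :
  measurable D -> (p D < +oo)%E -> (n D < +oo)%E ->
  exists (jp jn : {measure set T -> \bar R}) (P : set T),
  [/\ measurable P,
      forall E, measurable E -> (jp E + n (E `&` D) = jn E + p (E `&` D))%E,
      forall E, measurable E -> (jp E <= p (E `&` D))%E /\ (jn E <= n (E `&` D))%E,
      jp (~` P) = 0%E & jn P = 0%E].
Proof.
move=> mD pD nD.
pose cp := charge_of_finite_measure (mfrestr mD pD).
pose cn := charge_of_finite_measure (mfrestr mD nD).
pose c := cadd cp (cscale (-1) cn).
have [P [N h]] := Hahn_decomposition c.
have [[mP Ppos] [mN Nneg] PN PN0] := h.
have fp E : measurable E -> p (E `&` D) \is a fin_num.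
  by move=> mE; exact: (fin_num_measure cp).
have fn E : measurable E -> n (E `&` D) \is a fin_num.
  by move=> mE; exact: (fin_num_measure cn).
have cE E : c E = (p (E `&` D) - n (E `&` D))%E.
  by rewrite /c /cadd/= cscaleN1.
have NP : N = ~` P.
  apply/seteqP; split => t Nt.
    move=> Pt; have : (P `&` N) t by split.
    by rewrite PN0.
  by have : (P `|` N) t by [rewrite PN]; case.
pose jp : {measure set T -> \bar R} := jordan_pos h.
pose jn : {measure set T -> \bar R} := jordan_neg h.
have jpE E : measurable E -> jp E = c (E `&` P).
  by move=> mE; apply: etrans (cjordan_posE h E) _; rewrite /crestr0 mem_set.
have jnE E : measurable E -> jn E = (- c (E `&` N))%E.
  by move=> mE; apply: etrans (cjordan_negE h E) _; rewrite /crestr0 mem_set.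
exists jp, jn, P; split => //.
- move=> E mE; have : c E = (jp E - jn E)%E.
    apply: etrans (jordan_decomp h mE) _. rewrite /cadd /= /cscale.
    by rewrite EFinN mulN1e.
  rewrite cE; apply: sube_eq_add; rewrite ?fp ?fn//; exact: fin_num_measure.
- move=> E mE.
  have mEP : measurable (E `&` P) by exact: measurableI.
  have mEN : measurable (E `&` N) by exact: measurableI.
  have H (m : {measure set T -> \bar R}) A : measurable A -> (m (E `&` A `&` D) <= m (E `&` D))%E.
    move=> mA; apply: le_measure; rewrite ?inE; [|exact: measurableI|by move=> t [[]]].
    by do 2 apply: measurableI => //.
  split.
    rewrite jpE// cE.
    apply: le_trans (H p P mP).
    by rewrite leeBlDr ?fn// leeDl.
  rewrite jnE// cE.
  apply: le_trans (H n N mN).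
  by rewrite fin_num_oppeB ?fn// addeC leeBlDr ?fp// leeDl.
- have mC : measurable (~` P) by exact: measurableC.
  rewrite jpE// cE.
  by rewrite setICl set0I !measure0 sube0.
- rewrite jnE// cE.
  by rewrite PN0 set0I !measure0 sube0 oppe0.
Qed.

Section jordan.
Context {R : realType}.

(* The disjoint sets [I k] lie in the compact segments [F k] and cover
   (0, +oo). *)
Let F (k : nat) : set R := `[k.+1%:R^-1, k.+1%:R]%classic.
Let I := seqDU F.

Let mF k : measurable (F k). Proof. exact: measurable_itv. Qed.
Let mI k : measurable (I k). Proof. by apply: measurableD => //; apply: bigsetU_measurable. Qed.
Let FI k : I k `<=` F k. Proof. by move=> t []. Qed.
Let tI : trivIset setT I. Proof. exact: trivIset_seqDU. Qed.

Let cover : \bigcup_k I k = (`]0, +oo[%classic : set R).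
Proof.
rewrite -seqDU_bigcup_eq; apply/seteqP; split => t /=.
  move=> [k _]; rewrite /F/= !in_itv/= andbT => /andP[kt _].
  by apply: lt_le_trans kt; rewrite invr_gt0 ltr0n.
rewrite in_itv/= andbT => t0.
have [k [kt tk]] : exists k : nat, k.+1%:R^-1 < t /\ t < k.+1%:R.
  have /filter_ex[k [? ?]] : \forall k \near \oo, (k.+1%:R^-1 < t) /\ t < k%:R.
    by apply: filterI; [exact: near_infty_natSinv_lt (PosNum t0)|exact: nbhs_infty_gtr].
  exists k; split => //; apply: lt_trans (_ : k%:R < _) => //.
  by rewrite ltr_nat.
by exists k => //; rewrite /F/= in_itv/= !ltW.
Qed.

Let sumI (m : pos_radon R) (E : set R) : measurable E ->
  m E = (\sum_(0 <= k <oo) m (E `&` I k))%E.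
Proof.
move=> mE.
pose N : set R := `]-oo, 0]%classic.
have mN : measurable N by exact: measurable_itv.
have H : m (E `&` N) = 0%E.
  apply/eqP; rewrite -measure_le0 -(pos_radon_null m).
  by apply: le_measure; rewrite ?inE//; exact: measurableI.
have -> : m E = m (E `&` `]0, +oo[).
  apply: etrans (measureDI m mE mN) _; rewrite -[RHS]adde0 -H.
  by congr (m _ + _)%E; rewrite setDE /N setCitvl.
rewrite -cover setI_bigcupr measure_bigcup//.
- by apply: eq_eseriesl => k; rewrite in_setT.
- by move=> k _; exact: measurableI.
- exact: trivIset_setIl.
Qed.

(** As [p] and [n] may both have infinite mass, [p - n] is not a charge. Its
    restrictions to relatively compact pieces are charges, and their Hahn
    decompositions are glued together. *)
Lemma jordan_radon (p n : pos_radon R) : exists m : real_radon R,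
  forall E, measurable E -> (rad_pos m E + n E = rad_neg m E + p E)%E.
Proof.
have fI (m : pos_radon R) k : (m (I k) < +oo)%E.
  apply: (@le_lt_trans _ _ (m (F k))); first by apply: le_measure; rewrite ?inE.
  by apply: pos_radon_itv_fin; rewrite invr_gt0 ltr0n.
have /choice[jp /choice[jn /choice[P jP]]] : forall k, _ := fun k => finite_jordan (mI k) (fI p k) (fI n k).
pose mp : {measure set R -> \bar R} := mseries jp 0.
pose mn : {measure set R -> \bar R} := mseries jn 0.
have mP k : measurable (P k) by have [] := jP k.
have jle k E : measurable E -> (jp k E <= p (E `&` I k))%E /\ (jn k E <= n (E `&` I k))%E.
  by have [_ _ H _ _] := jP k; exact: H.
have mp_le E : measurable E -> (mp E <= p E)%E.
  move=> mE; rewrite (sumI p mE); apply: lee_nneseries => // k _.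
  exact: (jle k E mE).1.
have mn_le E : measurable E -> (mn E <= n E)%E.
  move=> mE; rewrite (sumI n mE); apply: lee_nneseries => // k _.
  exact: (jle k E mE).2.
have mp0 : mp `]-oo, 0]%classic = 0%E.
  by apply/eqP; rewrite -measure_le0 -(pos_radon_null p); exact: mp_le.
have mn0 : mn `]-oo, 0]%classic = 0%E.
  by apply/eqP; rewrite -measure_le0 -(pos_radon_null n); exact: mn_le.
have mpf (Q : set R) : compact Q -> Q `<=` `]0, +oo[ -> (mp Q < +oo)%E.
  move=> cQ Qp; apply: le_lt_trans (mp_le _ _) (pos_radon_fin p cQ Qp).
  exact: compact_measurable.
have mnf (Q : set R) : compact Q -> Q `<=` `]0, +oo[ -> (mn Q < +oo)%E.
  move=> cQ Qp; apply: le_lt_trans (mn_le _ _) (pos_radon_fin n cQ Qp).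
  exact: compact_measurable.
(* [A] collects the negative Hahn sets of the pieces. *)
pose A := \bigcup_k (~` P k `&` I k).
have mA : measurable A.
  by apply: bigcupT_measurable => k; apply: measurableI => //; exact: measurableC.
have AI k : A `&` I k = ~` P k `&` I k.
  apply/seteqP; split => [t [[j _ [Pj Ij]] Ik]|t [Pk Ik]].
    by split => //; rewrite (@tI k j Logic.I Logic.I (ex_intro _ t (conj Ik Ij))).
  by split => //; exists k.
have sing : mutually_singular (PosRadon mp0 mpf) (PosRadon mn0 mnf).
  exists A; split => //=; apply: eseries0 => k _ _.
  - have [_ _ _ jP0 _] := jP k.
    have mC : measurable (~` P k) by exact: measurableC.
    have mCI : measurable (~` I k) by exact: measurableC.
    apply/eqP; rewrite -measure_le0 (measureDI _ mA (mI k)) AI.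
    rewrite -[leRHS]adde0; apply: leeD.
      apply: le_trans ((jle k _ _).1) _; first exact: measurableD.
      by rewrite setDE -setIA setICl setI0 measure0.
    by rewrite -jP0; apply: le_measure; rewrite ?inE//; exact: measurableI.
  - have [_ _ _ _ jP0] := jP k.
    have mC : measurable (~` A) by exact: measurableC.
    apply/eqP; rewrite -measure_le0 (measureDI _ mC (mI k)).
    rewrite -[leRHS]adde0; apply: leeD.
      apply: le_trans ((jle k _ _).2) _; first exact: measurableD.
      by rewrite setDE -setIA setICl setI0 measure0.
    rewrite -jP0; apply: le_measure; rewrite ?inE//; first exact: measurableI.
    move=> t [nAt It]; apply: contrapT => Pt; apply: nAt; exists k => //.
exists (RealRadon sing) => E mE /=.
rewrite (sumI p mE) (sumI n mE) /mp /mn /mseries -!nneseriesD//.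
by apply: eq_eseriesr => k _; have [_ H _ _ _] := jP k; exact: H.
Qed.

End jordan.

(** * Growth of V and local boundedness of the dilations *)

Section growth.
Context {R : realType}.
Implicit Types rho : R -> R.

Lemma VfunE rho t : 0 < t -> Vfun rho t = expR (rho t * ln t).
Proof. by move=> t0; rewrite /Vfun /powR gt_eqF. Qed.

Lemma Vfun_gt0 rho t : 0 < t -> 0 < Vfun rho t.
Proof. by move=> t0; exact: powR_gt0. Qed.

(** Write [V = exp phi]. The conditions on a proximate order give that
    [x * phi' x] is bounded near infinity, so the mean value theorem bounds the
    increment of [phi] between [t] and [c * t] independently of [t]. *)
Lemma Vfun_comparable rho (c : R) : proximate_order rho -> 0 < c ->
  exists2 B : R, 0 <= B & \forall t \near +oo, Vfun rho (c * t) <= B * Vfun rho t.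
Proof.
move=> [rho0 [h [[h0 _ dh hln _] ->]]] c0.
pose B0 := `|rho0| + 2.
pose phi x := (rho0 + h x) * ln x.
pose dphi x := (rho0 + h x) * x^-1 + ln x * derive1 h x.
have [X [X1 XP]] : exists X : R, 1 < X /\ forall x, X < x -> `|x * dphi x| <= B0.
  have /cvgrPdist_lt/(_ _ ltr01) H1 := h0.
  have /cvgrPdist_lt/(_ _ ltr01) H2 := hln.
  have [X [_ XP]] := filterI H1 H2.
  exists (Order.max X 2); split; first by rewrite lt_max ltr1n orbT.
  move=> x; rewrite gt_max => /andP[Xx x2].
  have [/= ] := XP x Xx; rewrite !sub0r !normrN => h1 h2.
  have -> : x * dphi x = (rho0 + h x) + x * ln x * derive1 h x.
    by rewrite /dphi mulrDr mulrCA mulfV ?mulr1 ?mulrA// gt_eqF//; lra.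
  apply: le_trans (ler_normD _ _) _; rewrite /B0.
  by have := ler_normD rho0 (h x); lra.
have B00 : 0 <= B0 by rewrite /B0; have := normr_ge0 rho0; lra.
have dphiP x : X < x -> is_derive x 1 phi (dphi x).
  move=> Xx; have x0 : 0 < x by lra.
  have [|derh _] := dh x x0; first by rewrite gt_eqF//; lra.
  have dh' : is_derive x 1 h (derive1 h x) by rewrite derive1E; exact: derivableP.
  have dl := is_derive1_ln x0.
  have dr : is_derive x 1 (cst rho0 + h) (0 + derive1 h x) by exact: is_deriveD.
  have := is_deriveM dr dl; rewrite add0r.
  by rewrite (_ : _ + _ = dphi x).
have inc x y : X < x -> x <= y -> `|phi y - phi x| <= B0 * ((y - x) / x).
  move=> Xx xy.
  have [z zxy ->] : exists2 z, z \in `[x, y] & phi y - phi x = dphi z * (y - x).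
    apply: MVT_segment => //.
      by move=> z; rewrite in_itv/= => /andP[xz _]; apply: dphiP; exact: lt_trans xz.
    apply: continuous_in_subspaceT => z; rewrite inE/= in_itv/= => /andP[xz _].
    apply: differentiable_continuous; apply/derivable1_diffP.
    by have := dphiP z (lt_le_trans Xx xz) => -[].
  move: zxy; rewrite in_itv/= => /andP[xz zy].
  have x0 : 0 < x by lra.
  have z0 : 0 < z by lra.
  rewrite normrM (ger0_norm (_ : 0 <= y - x)) ?subr_ge0// (mulrC _ x^-1) mulrA.
  apply: ler_wpM2r; first by rewrite subr_ge0.
  rewrite ler_pdivlMr//; apply: le_trans (XP z (lt_le_trans Xx xz)).
  by rewrite normrM (gtr0_norm z0) mulrC ler_wpM2r.
(* The interval between [t] and [c * t], divided by its left end, has length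
   [c - 1] or [c^-1 - 1]. *)
exists (expR (B0 * (c + c^-1))); first exact: expR_ge0.
have ci0 : 0 < c^-1 by rewrite invr_gt0.
near=> t.
have t0 : 0 < t by near: t; apply: nbhs_pinfty_gt; exact: num_real.
have Xt : X < t by near: t; apply: nbhs_pinfty_gt; exact: num_real.
have Xct : X < c * t.
  rewrite -ltr_pdivrMl//; near: t; apply: nbhs_pinfty_gt; exact: num_real.
have ct0 : 0 < c * t by rewrite mulr_gt0.
rewrite !VfunE// -expRD ler_expR -lerBlDr.
change (phi (c * t) - phi t <= B0 * (c + c^-1)).
have [tc|ct] := leP t (c * t).
  apply: le_trans (ler_norm _) _; apply: le_trans (inc _ _ Xt tc) _.
  apply: ler_wpM2l => //; rewrite mulrBl mulfK ?gt_eqF// divff ?gt_eqF//; lra.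
rewrite -opprB; apply: le_trans (ler_norm _) _; rewrite normrN.
apply: le_trans (inc _ _ Xct (ltW ct)) _; apply: ler_wpM2l => //.
by rewrite mulrBl divff ?gt_eqF// invfM mulrCA divff ?gt_eqF//; lra.
Unshelve. all: by end_near. Qed.

End growth.

Section variation.
Context {R : realType}.

Lemma ler_normc_Re (x y : R) : `|x| <= Normc.normc (x +i* y)%C.
Proof. by rewrite /= -sqrtr_sqr ler_wsqrtr// lerDl sqr_ge0. Qed.

Lemma ler_normc_Im (x y : R) : `|y| <= Normc.normc (x +i* y)%C.
Proof. by rewrite /= -sqrtr_sqr ler_wsqrtr// lerDr sqr_ge0. Qed.

(** A set separating the two parts of [m] cuts [c, d] into two pieces; on each of
    them the value of [m] is, up to sign, the mass of one part on all of
    [c, d]. *)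
Lemma parts_le_variation (mu : radon R) (m : real_radon R) (c d : R) : 0 < c ->
  (forall A, `|real_radon_val m A| <= Normc.normc (radon_val mu A)) ->
  (rad_pos m `[c, d]%classic <= radon_variation mu `[c, d]%classic)%E /\
  (rad_neg m `[c, d]%classic <= radon_variation mu `[c, d]%classic)%E.
Proof.
move=> c0 mval; set Q := `[c, d]%classic.
have mQ : measurable Q by exact: measurable_itv.
have [A [mA pA nA]] := rad_singular m.
pose F k := if k is k'.+1 then if k' is 0%N then Q `&` A else set0 else Q `\` A.
have mF k : measurable (F k).
  by case: k => [|[|k]] /=; [exact: measurableD|exact: measurableI|].
have FQ k : F k `<=` Q by case: k => [|[|k]] /= t // [].
have rF k : rel_compact (F k).
  exists Q; split => //; first exact: (@segment_compact R c d).
  by move=> t /=; rewrite !in_itv/= andbT => /andP[/(lt_le_trans c0)].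
have tF : trivIset setT F.
  move=> [|[|i]] [|[|j]] _ _ [t []] //=.
    by move=> [_ nAt] [_ At].
  by move=> [_ At] [_ nAt].
have UF : \bigcup_k F k = Q.
  apply/seteqP; split => [t [k _ /FQ//]|t Qt].
  by have [At|nAt] := pselect (A t); [exists 1%N|exists 0%N].
have key k : (`|real_radon_val m (F k)|%:E <= radon_variation mu Q)%E.
  apply: (@le_trans _ _ (\sum_(0 <= k <oo) (Normc.normc (radon_val mu (F k)))%:E)%E).
    rewrite (@nneseriesD1 _ _ k)//; last first.
      by move=> j _; rewrite lee_fin (le_trans _ (mval _)).
    rewrite -[leLHS]adde0; apply: leeD; first by rewrite lee_fin mval.
    by apply: nneseries_ge0 => j _ _; rewrite lee_fin (le_trans _ (mval _)).
  by apply: ereal_sup_ubound; exists F.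
have fin (p : pos_radon R) E : measurable E -> E `<=` Q -> p E \is a fin_num.
  move=> mE EQ; rewrite ge0_fin_numE//; apply: le_lt_trans (pos_radon_itv_fin p d c0).
  by apply: le_measure; rewrite ?inE.
have null (p : pos_radon R) B E : measurable B -> measurable E -> p B = 0%E -> E `<=` B -> p E = 0%E.
  by move=> mB mE pB EB; apply/eqP; rewrite -measure_le0 -pB; apply: le_measure; rewrite ?inE.
have mC : measurable (~` A) by exact: measurableC.
have mQA : measurable (Q `&` A) by exact: measurableI.
have mQD : measurable (Q `\` A) by exact: measurableD.
have sD : Q `\` A `<=` ~` A by move=> t [].
have sI : Q `&` A `<=` A by move=> t [].
have sDQ : Q `\` A `<=` Q by move=> t [].
have sIQ : Q `&` A `<=` Q by move=> t [].
have DI (p : pos_radon R) : p Q = (p (Q `\` A) + p (Q `&` A))%E by exact: measureDI.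
split.
  apply: le_trans (key 0%N); rewrite /real_radon_val /=.
  rewrite (null _ _ _ mC mQD nA sD) subr0 ger0_norm ?fine_ge0// fineK ?fin//.
  by rewrite DI (null _ _ _ mA mQA pA sI) adde0.
apply: le_trans (key 1%N); rewrite /real_radon_val /=.
rewrite (null _ _ _ mA mQA pA sI) sub0r normrN ger0_norm ?fine_ge0// fineK ?fin//.
by rewrite DI (null _ _ _ mC mQD nA sD) add0e.
Qed.

Definition V_bounded (rho : R -> R) (p : pos_radon R) : Prop :=
  exists2 C : R, 0 <= C & forall r : R, 1 <= r ->
    (p `[r, (expR 1 * r)%R]%classic <= (C * Vfun rho r)%:E)%E.

Lemma M_infty_V_bounded rho (mu : radon R) : M_infty rho mu ->
  [/\ V_bounded rho (rad_pos (rad_re mu)), V_bounded rho (rad_neg (rad_re mu)),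
      V_bounded rho (rad_pos (rad_im mu)) & V_bounded rho (rad_neg (rad_im mu))].
Proof.
rewrite /M_infty /=; set S := [set _ | _ in _] => Sfin.
have [C C0 CP] : exists2 C : R, 0 <= C & forall r : R, 1 <= r ->
    (radon_variation mu `[r, (expR 1 * r)%R]%classic <= (C * Vfun rho r)%:E)%E.
  have ub (r : R) : 1 <= r -> (radon_variation mu `[r, (expR 1 * r)%R]%classic
                             * ((Vfun rho r)^-1)%:E <= ereal_sup S)%E.
    by move=> r1; apply: ereal_sup_ubound; exists r.
  have [C CE] : exists C : R, (ereal_sup S <= C%:E)%E.
    by move: Sfin; case: (ereal_sup S) => [s| |] // _; [exists s|exists 0; rewrite leNye].
  exists `|C| => // r r1; have V0 : 0 < Vfun rho r by apply: Vfun_gt0; lra.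
  rewrite EFinM -lee_pdivrMr//; apply: le_trans (ub r r1) _; apply: le_trans CE _.
  by rewrite lee_fin ler_norm.
have re A : `|real_radon_val (rad_re mu) A| <= Normc.normc (radon_val mu A).
  exact: ler_normc_Re.
have im A : `|real_radon_val (rad_im mu) A| <= Normc.normc (radon_val mu A).
  exact: ler_normc_Im.
have H (r : R) : 1 <= r -> 0 < r by move=> r1; lra.
split; exists C => // r r1; apply: le_trans (CP r r1).
- exact: (parts_le_variation _ (H r r1) re).1.
- exact: (parts_le_variation _ (H r r1) re).2.
- exact: (parts_le_variation _ (H r r1) im).1.
- exact: (parts_le_variation _ (H r r1) im).2.
Qed.

(** [c, d] is covered by finitely many segments [c e^j, c e^(j+1)]; the dilated
    mass of such a segment is the mass of [r, er], with r = c e^j t, divided by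
    V(t), and V(r) is comparable with V(t). *)
Lemma dil_locally_bounded rho (p : pos_radon R) (r : nat -> {posnum R}) :
  proximate_order rho -> V_bounded rho p -> (r n)%:num @[n --> \oo] --> +oo ->
  locally_bounded (fun n => pos_radon_dil rho (r n) p).
Proof.
move=> prho [C C0 CP] roo.
have dilE (t : {posnum R}) (a b : R) : pos_radon_dil rho t p `[a, b]%classic =
    ((Vfun rho t%:num)^-1%:E * p `[(a * t%:num)%R, (b * t%:num)%R]%classic)%E.
  rewrite pos_radon_dilE; congr (_ * p _)%E.
  by apply/seteqP; split => s /=; rewrite /shrink !in_itv/= ler_pdivlMr// ler_pdivrMr.
have step (c : R) : 0 < c -> exists M : R, \forall n \near \oo,
    (pos_radon_dil rho (r n) p `[c, (expR 1 * c)%R]%classic <= M%:E)%E.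
  move=> c0; have [B B0 BP] := Vfun_comparable prho c0.
  exists (C * B); near=> n.
  have Bn : Vfun rho (c * (r n)%:num) <= B * Vfun rho (r n)%:num by near: n; exact: roo BP.
  have cr : 1 <= c * (r n)%:num.
    rewrite -ler_pdivrMl//; near: n.
    exact: (cvgry_ge roo).
  have V0 : 0 < Vfun rho (r n)%:num by exact: Vfun_gt0.
  rewrite dilE -mulrA muleC lee_pdivrMr// -EFinM.
  apply: le_trans (CP _ cr) _.
  by rewrite lee_fin -mulrA; apply: ler_wpM2l.
move=> c d c0.
have [J dJ] : exists J : nat, d <= c * expR J%:R.
  have /filter_ex[J dJ] : \forall J \near \oo, d / c < J%:R := nbhs_infty_gtr _.
  exists J; rewrite mulrC -ler_pdivrMr//; apply: le_trans (ltW dJ) _.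
  by apply: le_trans (expR_ge1Dx _); rewrite lerDr.
have main K : exists M : R, \forall n \near \oo,
    (pos_radon_dil rho (r n) p `[c, (c * expR K%:R)%R]%classic <= M%:E)%E.
  elim: K => [|K [M MP]].
    have [M MP] := step c c0; exists M; near=> n.
    apply: (@le_trans _ _ (pos_radon_dil rho (r n) p `[c, (expR 1 * c)%R]%classic)); last by near: n.
    apply: le_measure; rewrite ?inE//; apply: subset_itvl; rewrite bnd_simp.
    by rewrite expR0 mulr1 ler_peMl ?(ltW c0)// -[leLHS]expR0 ler_expR.
  have [|N NP] := step (c * expR K%:R); first by rewrite mulr_gt0 ?expR_gt0.
  exists (M + N); near=> n.
  have h1 : (pos_radon_dil rho (r n) p `[c, (c * expR K%:R)%R]%classic <= M%:E)%E by near: n.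
  have h2 : (pos_radon_dil rho (r n) p `[(c * expR K%:R)%R, (expR 1 * (c * expR K%:R))%R]%classic
      <= N%:E)%E by near: n.
  apply: le_trans (leeD h1 h2); rewrite -[in leLHS]natr1 expRD.
  apply: le_trans (measureU2 _ _ _) => //; apply: le_measure; rewrite ?inE//; first exact: measurableU.
  move=> t /=; rewrite !in_itv/= => /andP[ct tK].
  have [h|/ltW h] := leP t (c * expR K%:R); [left|right]; apply/andP; split => //.
  by apply: le_trans tK _; rewrite (mulrC (expR 1)) mulrA.
have [M MP] := main J; exists M; apply: filterS MP => n; apply: le_trans.
by apply: le_measure; rewrite ?inE//; apply: subset_itvl; rewrite bnd_simp.
Unshelve. all: by end_near. Qed.

End variation.

(** * Real measures are determined by integrals of test functions *)

Section trapezoid.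
Context {R : realType}.

Definition clamp (s : R) : R := Order.max 0 (Order.min 1 s).

Lemma clamp0 s : s <= 0 -> clamp s = 0.
Proof. by move=> s0; rewrite /clamp; apply/max_idPl; rewrite ge_min s0 orbT. Qed.

Lemma clamp1 s : 1 <= s -> clamp s = 1.
Proof. by move=> s1; rewrite /clamp (min_idPl s1); apply/max_idPr. Qed.

Lemma clamp_ge0 s : 0 <= clamp s.
Proof. by rewrite /clamp le_max lexx. Qed.

Lemma clamp_le1 s : clamp s <= 1.
Proof. by rewrite /clamp ge_max ler01 ge_min lexx. Qed.

Lemma clamp_nd : {homo clamp : s t / s <= t}.
Proof.
move=> s t st; rewrite /clamp; have [s0|s0] := leP s 0.
  by rewrite (_ : Order.max 0 (Order.min 1 s) = 0) ?le_max ?lexx//; exact: clamp0.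
rewrite ge_max le_max lexx/= le_max; apply/orP; right.
by rewrite le_min !ge_min lexx st orbT.
Qed.

Lemma continuous_clamp : continuous clamp.
Proof.
move=> s; rewrite /clamp; apply: continuous_max; first exact: cst_continuous.
by apply: continuous_min; [exact: cst_continuous|exact: cvg_id].
Qed.

(** The ramps of slope [k] start at [x] and at [y], so that for increasing [k] the
    limit is the indicator function of the half-open interval ]x, y], and the
    intervals of this kind generate the Borel sets. *)
Definition trapezoid (x y k t : R) : R := clamp (k * (t - x)) - clamp (k * (t - y)).

Lemma continuous_trapezoid x y k : continuous (trapezoid x y k).
Proof.
move=> t; have H z : {for t, continuous (fun t => clamp (k * (t - z)))}.
  apply: continuous_comp; last exact: continuous_clamp.
  apply: continuousM; first exact: cst_continuous.
  by apply: continuousB; [exact: cvg_id|exact: cst_continuous].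
exact: (cvgB (H x) (H y)).
Qed.

Lemma trapezoid_ge0 x y k t : 0 <= k -> x <= y -> 0 <= trapezoid x y k t.
Proof.
move=> k0 xy; rewrite subr_ge0; apply: clamp_nd; apply: ler_wpM2l => //; lra.
Qed.

Lemma trapezoid_le1 x y k t : trapezoid x y k t <= 1.
Proof.
rewrite /trapezoid; have := clamp_ge0 (k * (t - y)).
have := clamp_le1 (k * (t - x)); lra.
Qed.

Lemma trapezoid_supp x y k t : 0 < k -> x <= y -> trapezoid x y k t != 0 ->
  x < t < y + k^-1.
Proof.
move=> k0 xy; apply: contraNT; rewrite negb_and -!leNgt => /orP[tx|yt].
  by rewrite /trapezoid !clamp0 ?subrr// pmulr_rle0// subr_le0// (le_trans tx).
have h : 1 <= k * (t - y).
  by rewrite -ler_pdivrMl// mulr1; lra.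
rewrite /trapezoid !clamp1 ?subrr//; apply: le_trans h _.
by rewrite ler_pM2l//; lra.
Qed.

Lemma trapezoid_cvg x y (del : R) t : 0 < del -> x <= y ->
  trapezoid x y (k.+1%:R / del) t @[k --> \oo] --> (\1_(`]x, y]%classic) t : R).
Proof.
move=> del0 xy; rewrite indicE.
have lim z : clamp (k.+1%:R / del * (t - z)) @[k --> \oo] --> ((z < t)%R%:R : R).
  have [zt|tz] := ltP z t; last first.
    apply: cvg_near_cst; apply: nearW => k; apply: clamp0.
    by rewrite pmulr_rle0 ?subr_le0// divr_gt0.
  apply: cvg_near_cst; near=> k; apply: clamp1.
  rewrite -ler_pdivrMr ?subr_gt0// ler_pdivlMr// mul1r.
  apply: (@le_trans _ _ k%:R); last by rewrite ler_nat.
  by near: k; exact: nbhs_infty_ger.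
have -> : (t \in `]x, y]%classic)%:R = (x < t)%R%:R - (y < t)%R%:R :> R.
  have -> : (t \in `]x, y]%classic) = (x < t) && (t <= y).
    by apply/idP/idP; rewrite inE/= in_itv.
  have [yt|ty] := ltP y t; first by rewrite (le_lt_trans xy yt) subrr.
  by rewrite andbT subr0.
by apply: cvgB; exact: lim.
Unshelve. all: by end_near. Qed.

Lemma trapezoid_integral_cvg (p : pos_radon R) (x y del : R) :
  0 < x -> x <= y -> 0 < del ->
  Rintegral p `]0, +oo[ (trapezoid x y (k.+1%:R / del)) @[k --> \oo] --> oc_mass p x y.
Proof.
move=> x0 xy del0.
pose D : set R := `]0, +oo[%classic.
have mD : measurable D by exact: measurable_itv.
pose f (k : nat) (t : R) := (trapezoid x y (k.+1%:R / del) t)%:E.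
pose g (t : R) := (\1_(`[x, y + del]%classic) t : R)%:E.
have kd (k : nat) : 0 < k.+1%:R / del by rewrite divr_gt0.
have H : (\int[p]_(t in D) f k t)%E @[k --> \oo] -->
    (\int[p]_(t in D) (\1_(`]x, y]%classic) t : R)%:E)%E.
  apply: (@dominated_cvg _ _ _ p D mD f _ g).
  - move=> k; apply/measurable_EFinP; apply: measurable_funTS.
    by apply: continuous_measurable_fun; exact: continuous_trapezoid.
  - move=> t _; apply: cvg_EFin; first by apply: nearW => k.
    exact: trapezoid_cvg.
  - by move=> t _; rewrite /g.
  - apply: bounded_compact_integrable => //; split.
      by apply: measurable_funTS; exact: measurable_indic.
    exists x, (y + del), 1; split => // s s0.
      by rewrite indicE; case: (_ \in _); rewrite ?normr1 ?normr0.
    by rewrite indicE pnatr_eq0 eqb0 negbK inE/= in_itv.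
  - move=> k t _; rewrite /f /g lee_fin ger0_norm; last first.
      by apply: trapezoid_ge0 => //; exact: ltW.
    have [->|tz] := eqVneq (trapezoid x y (k.+1%:R / del) t) 0; first by rewrite indicE ler0n.
    have /andP[xt ty] := trapezoid_supp (kd k) xy tz.
    rewrite indicE mem_set ?trapezoid_le1//= in_itv/= (ltW xt)/=.
    apply: le_trans (ltW ty) _; rewrite lerD2l invf_div ler_pdivrMr// ler_peMr//; first exact: ltW.
    by rewrite ler1n.
have E : (\int[p]_(t in D) (\1_(`]x, y]%classic) t : R)%:E)%E = (oc_mass p x y)%:E.
  rewrite integral_indic// setIidl ?oc_massE// => t.
  by rewrite /D /= !in_itv/= => /andP[/(lt_trans x0) -> _].
rewrite E in H; exact: (fine_cvg H).
Qed.

End trapezoid.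

Section no_charge.
Context {R : realType}.

Definition signed_int (m : real_radon R) (D : set R) (f : R -> R) : R :=
  Rintegral (rad_pos m) D f - Rintegral (rad_neg m) D f.

(** Trapezoids show that both parts of [m] give the same mass to half-open
    subintervals of ]c, d], hence to all its Borel subsets; as the parts are
    mutually singular, they vanish there. *)
Lemma null_oc_of_test (m : real_radon R) (c d d' : R) : 0 < c -> d < d' ->
  (forall f, real_test f -> (forall t : R, 0 < t -> f t != 0 -> c < t < d') ->
     signed_int m `]0, +oo[ f = 0) ->
  rad_pos m `]c, d]%classic = 0%E /\ rad_neg m `]c, d]%classic = 0%E.
Proof.
move=> c0 dd' mf.
pose del := d' - d; have del0 : 0 < del by rewrite subr_gt0.
have oc x y : c <= x -> x <= y -> y <= d -> rad_pos m `]x, y]%classic = rad_neg m `]x, y]%classic.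
  move=> cx xy yd; have x0 : 0 < x by exact: lt_le_trans cx.
  rewrite !oc_massE//; congr EFin.
  have Hp := @trapezoid_integral_cvg _ (rad_pos m) x y del x0 xy del0.
  have Hn := @trapezoid_integral_cvg _ (rad_neg m) x y del x0 xy del0.
  have E k : Rintegral (rad_pos m) `]0, +oo[ (trapezoid x y (k.+1%:R / del)) =
      Rintegral (rad_neg m) `]0, +oo[ (trapezoid x y (k.+1%:R / del)).
    have kd : 0 < k.+1%:R / del by rewrite divr_gt0.
    have supp t : 0 < t -> trapezoid x y (k.+1%:R / del) t != 0 -> c < t < d'.
      move=> t0 /(trapezoid_supp kd xy)/andP[xt ty].
      rewrite (le_lt_trans cx)//= (lt_le_trans ty)//.
      apply: (@le_trans _ _ (d + del)); last by rewrite /del; lra.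
      apply: lerD => //; rewrite invf_div ler_pdivrMr// ler_peMr//; first exact: ltW.
      by rewrite ler1n.
    apply/eqP; rewrite -subr_eq0; apply/eqP; apply: mf => //.
    split; first by move=> t _; exact: continuous_trapezoid.
    by exists c, d'; split => // t t0 /(supp _ t0)/andP[? ?]; rewrite !ltW.
  apply/eqP; rewrite eq_le; apply/andP; split.
    by apply: ler_cvg_to Hp Hn _; apply: nearW => k; rewrite E.
  by apply: ler_cvg_to Hn Hp _; apply: nearW => k; rewrite E.
pose D : set R := `]c, d]%classic.
have mD : measurable D by exact: measurable_itv.
have eqD E : measurable E -> rad_pos m (E `&` D) = rad_neg m (E `&` D).
  move=> mE.
  apply: (@measure_unique _ R R (@ocitv R) (fun k => `](- k%:R), k%:R]%classic) _ _ _ _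
     (mrestr (rad_pos m) mD) (mrestr (rad_neg m) mD)) mE => //.
  - exact: ocitvI.
  - by move=> k; exact: is_ocitv.
  - apply/seteqP; split => // t _.
    have /filter_ex[k tk] : \forall k \near \oo, `|t| < k%:R := nbhs_infty_gtr _.
    exists k => //=; rewrite in_itv/=.
    by move: tk; rewrite ltr_norml => /andP[-> /ltW ->].
  - move=> _ [[a b] _ <-] /=; rewrite /mrestr.
    have -> : `]a, b]%classic `&` D = `]Order.max a c, Order.min b d]%classic.
      apply/seteqP; split => t /=; rewrite /D /= !in_itv/= gt_max le_min.
        by move=> [/andP[-> ->] /andP[-> ->]].
      by move=> /andP[/andP[-> ->] /andP[-> ->]].
    have [h|h] := leP (Order.max a c) (Order.min b d).
      by apply: oc => //; rewrite ?le_max ?ge_min ?lexx ?orbT.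
    by rewrite set_itv_ge ?measure0// bnd_simp -leNgt ltW.
  - move=> k; rewrite /= /mrestr; apply: le_lt_trans (pos_radon_oc_fin (rad_pos m) d c0).
    by apply: le_measure; rewrite ?inE//; exact: measurableI.
have [A [mA pA nA]] := rad_singular m.
have mC : measurable (~` A) by exact: measurableC.
have null (p : pos_radon R) B E : measurable B -> measurable E -> p B = 0%E -> p (B `&` E) = 0%E.
  by move=> mB mE pB; apply/eqP; rewrite -measure_le0 -pB; apply: le_measure; rewrite ?inE//; exact: measurableI.
have DI (p : pos_radon R) : p D = (p (~` A `&` D) + p (A `&` D))%E.
  rewrite setIC -setDE (setIC A); exact: measureDI.
split.
  by rewrite (DI (rad_pos m)) eqD// (null _ _ _ mC mD nA) (null _ _ _ mA mD pA) adde0.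
by rewrite (DI (rad_neg m)) -(eqD A)// (null _ _ _ mC mD nA) (null _ _ _ mA mD pA) adde0.
Qed.

End no_charge.

(** * Selection of widely convergent subsequences *)

Section complex_limits.
Context {R : realType}.

Lemma normC_real (z : cplx R) : `|z| = ((Normc.normc z)%:C)%C.
Proof. by []. Qed.

Lemma pos_complex (e : R[i]) : 0 < e -> exists2 e' : R, 0 < e' & e = (e'%:C)%C.
Proof.
case: e => a b; rewrite ltcE /= => /andP[/eqP -> a0].
by exists a.
Qed.

Lemma cvg_ReIm (T : Type) (F : set_system T) {FF : Filter F} (f : T -> cplx R) (l : cplx R) :
  complex.Re (f t) @[t --> F] --> complex.Re l ->
  complex.Im (f t) @[t --> F] --> complex.Im l ->
  f t @[t --> F] --> l.
Proof.
case: l => u v /= /cvgrPdist_lt hre /cvgrPdist_lt him; apply/cvgrPdist_lt => e /pos_complex[e' e0 ->].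
have e2 : 0 < e' / 2 by lra.
apply: filterS2 (hre _ e2) (him _ e2) => t; case: (f t) => x y /= h1 h2.
rewrite ltcR.
apply: le_lt_trans (_ : `|u - x| + `|v - y| < _); last lra.
rewrite /= -[leRHS]ger0_norm ?addr_ge0// -sqrtr_sqr ler_wsqrtr//.
by rewrite [leRHS]sqrrD !real_normK ?num_real// lerD2r lerDl mulrn_wge0// mulr_ge0.
Qed.

Lemma cvg_Re (T : Type) (F : set_system T) {FF : Filter F} (f : T -> cplx R) (l : cplx R) :
  f t @[t --> F] --> l -> complex.Re (f t) @[t --> F] --> complex.Re l.
Proof.
case: l => u v /cvgrPdist_lt h; apply/cvgrPdist_lt => e e0.
have ec : 0 < (e%:C)%C by rewrite ltcR.
apply: filterS (h _ ec) => t; case: (f t) => x y /=.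
rewrite ltcR => h'; apply: le_lt_trans h'; exact: (ler_normc_Re (u - x) (v - y)).
Qed.

Lemma cvg_Im (T : Type) (F : set_system T) {FF : Filter F} (f : T -> cplx R) (l : cplx R) :
  f t @[t --> F] --> l -> complex.Im (f t) @[t --> F] --> complex.Im l.
Proof.
case: l => u v /cvgrPdist_lt h; apply/cvgrPdist_lt => e e0.
have ec : 0 < (e%:C)%C by rewrite ltcR.
apply: filterS (h _ ec) => t; case: (f t) => x y /=.
rewrite ltcR => h'; apply: le_lt_trans h'; exact: (ler_normc_Im (u - x) (v - y)).
Qed.

End complex_limits.

Section real_wide.
Context {R : realType}.

Definition real_wide_cvg (m_ : nat -> real_radon R) (l : real_radon R) : Prop :=
  forall f, real_test f -> signed_int (m_ n) `]0, +oo[ f @[n --> \oo] --> signed_int l `]0, +oo[ f.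

Lemma jordan_signed_int (m : real_radon R) (p n : pos_radon R) (f : R -> R) :
  (forall E, measurable E -> (rad_pos m E + n E = rad_neg m E + p E)%E) ->
  bounded_compact f ->
  signed_int m `]0, +oo[ f = Rintegral p `]0, +oo[ f - Rintegral n `]0, +oo[ f.
Proof.
move=> mpn bf.
pose D : set R := `]0, +oo[%classic.
have mD : measurable D by exact: measurable_itv.
have int (q : pos_radon R) : q.-integrable D (EFin \o f) by exact: bounded_compact_integrable.
have fin (q : pos_radon R) : (\int[q]_(t in D) (EFin \o f) t)%E \is a fin_num.
  exact: integrable_fin_num (int q).
have : (\int[measure_add (rad_pos m) n]_(t in D) (EFin \o f) t =
        \int[measure_add (rad_neg m) p]_(t in D) (EFin \o f) t)%E.
  apply: eq_measure_integral => E mE _.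
  by apply: etrans (measure_addE _ _ _) (etrans (mpn E mE) (esym (measure_addE _ _ _))).
rewrite (integral_measure_add mD (int _) (int _)) (integral_measure_add mD (int _) (int _)).
move=> /(congr1 fine); rewrite (fineD (fin (rad_pos m)) (fin n)) (fineD (fin (rad_neg m)) (fin p)).
rewrite /signed_int /Rintegral -/D /comp => h.
lra.
Qed.

Lemma real_selection (m_ : nat -> real_radon R) :
  locally_bounded (fun n => rad_pos (m_ n)) ->
  locally_bounded (fun n => rad_neg (m_ n)) ->
  exists (s : nat -> nat) (l : real_radon R),
    s n @[n --> \oo] --> \oo /\ real_wide_cvg (m_ \o s) l.
Proof.
move=> bp bn.
have [s1 [l1 [s1oo cv1]]] := helly_selection bp.
have [s2 [l2 [s2oo cv2]]] := helly_selection (locally_bounded_comp s1oo bn).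
have [m mP] := jordan_radon l1 l2.
exists (s1 \o s2), m; split; first exact: (cvg_comp _ _ s2oo s1oo).
move=> f tf; rewrite (jordan_signed_int mP (real_test_bounded_compact tf)).
rewrite /signed_int; apply: cvgB; last exact: cv2.
exact: (cvg_comp _ _ s2oo (cv1 f tf)).
Qed.

Lemma real_wide_cvg_comp (m_ : nat -> real_radon R) l (s : nat -> nat) :
  s n @[n --> \oo] --> \oo -> real_wide_cvg m_ l -> real_wide_cvg (m_ \o s) l.
Proof. by move=> soo cv f tf; exact: (cvg_comp _ _ soo (cv f tf)). Qed.

End real_wide.

Section complex_wide.
Context {R : realType}.
Implicit Types (mu nu : radon R).

Lemma integral_radonE mu (D : set R) (f : R -> cplx R) :
  integral_radon mu D f =
  ((signed_int (rad_re mu) D (@complex.Re R \o f)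
    - signed_int (rad_im mu) D (@complex.Im R \o f))
   +i* (signed_int (rad_re mu) D (@complex.Im R \o f)
    + signed_int (rad_im mu) D (@complex.Re R \o f)))%C.
Proof.
rewrite /integral_radon /integral_real_radon -!/(signed_int _ _ _).
by apply/eqP; rewrite eq_complex /= /comp; apply/andP; split; apply/eqP; ring.
Qed.

Lemma test_function_ReIm (f : R -> cplx R) : test_function f ->
  real_test (@complex.Re R \o f) /\ real_test (@complex.Im R \o f).
Proof.
move=> [cf kf sf]; have [c [d [c0 Qcd]]] := compact_sub_itv kf sf.
have supp t : 0 < t -> f t != 0 -> c <= t <= d.
  move=> t0 ft; have : fun_support f t by apply: subset_closure.
  by move=> /Qcd /=; rewrite in_itv.
split; (split; [move=> t t0|exists c, d; split => // t t0 ft; apply: supp => //]).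
- exact: cvg_Re (cf t t0).
- by apply: contra_neq ft => /= ->.
- exact: cvg_Im (cf t t0).
- by apply: contra_neq ft => /= ->.
Qed.

Lemma test_function_of_ReIm (f : R -> cplx R) :
  real_test (@complex.Re R \o f) -> real_test (@complex.Im R \o f) -> test_function f.
Proof.
move=> [cfr [c1 [d1 [c10 fcd1]]]] [cfi [c2 [d2 [c20 fcd2]]]].
pose c := Order.min c1 c2; pose d := Order.max d1 d2.
have sub : fun_support f `<=` `[c, d]%classic.
  have : closed (`[c, d]%classic : set R) by exact: interval_closed.
  rewrite closure_id => ->; apply: closure_subset => t /= [t0 ft].
  rewrite in_itv/= /c /d ge_min le_max.
  have [re0|/fcd1 H] := eqVneq (complex.Re (f t)) 0; last by have /andP[-> ->] := H t0.
  have [im0|/fcd2 H] := eqVneq (complex.Im (f t)) 0.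
    by move: ft; rewrite eq_complex /= re0 im0 eqxx.
  by have /andP[-> ->] := H t0; rewrite !orbT.
split.
- by move=> t t0; apply: cvg_ReIm; [exact: cfr|exact: cfi].
- apply: (@subclosed_compact _ _ `[c, d]%classic) => //; first exact: closed_closure.
  exact: segment_compact.
- move=> t /sub /=; rewrite !in_itv/= andbT => /andP[ct _].
  by apply: lt_le_trans ct; rewrite /c lt_min c10.
Qed.

Lemma real_test_test_function (f : R -> R) : real_test f ->
  test_function (fun t => (f t)%:C%C : cplx R).
Proof.
move=> tf; apply: test_function_of_ReIm => //; split.
  by move=> t _; exact: cst_continuous.
by exists 1, 1; split => // t _; rewrite /= eqxx.
Qed.

(** Real-valued test functions suffice, and their integrals against the real and
    imaginary parts of a measure can be read off from the coordinates of its
    complex integral. *)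
Lemma wide_cvgP (mu_ : nat -> radon R) nu : wide_cvg mu_ nu <->
  real_wide_cvg (fun n => rad_re (mu_ n)) (rad_re nu) /\
  real_wide_cvg (fun n => rad_im (mu_ n)) (rad_im nu).
Proof.
split.
  move=> cv.
  have s0 (m : real_radon R) : signed_int m `]0, +oo[ (fun=> 0) = 0.
    rewrite /signed_int.
    have H (p : pos_radon R) : Rintegral p `]0, +oo[ (fun=> 0) = 0 by rewrite Rintegral_cst// mul0r.
    by rewrite !H subrr.
  have H f : real_test f -> integral_radon (mu_ n) `]0, +oo[ (fun t => (f t)%:C%C : cplx R) @[n --> \oo]
      --> integral_radon nu `]0, +oo[ (fun t => (f t)%:C%C : cplx R).
    by move=> tf; exact/cv/real_test_test_function.
  split => f tf.
    have := @cvg_Re R _ \oo _ _ _ (H f tf); rewrite integral_radonE.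
    under eq_fun do rewrite integral_radonE /= s0 subr0.
    by rewrite /= s0 subr0; apply.
  have := @cvg_Im R _ \oo _ _ _ (H f tf); rewrite integral_radonE.
  under eq_fun do rewrite integral_radonE /= s0 add0r.
  by rewrite /= s0 add0r; apply.
move=> [cre cim] f /test_function_ReIm[tr ti].
rewrite integral_radonE; under eq_fun do rewrite integral_radonE.
apply: cvg_ReIm => /=.
- by apply: cvgB; [exact: cre|exact: cim].
- by apply: cvgD; [exact: cre|exact: cim].
Qed.

Definition radon_locally_bounded (mu_ : nat -> radon R) : Prop :=
  [/\ locally_bounded (fun n => rad_pos (rad_re (mu_ n))),
      locally_bounded (fun n => rad_neg (rad_re (mu_ n))),
      locally_bounded (fun n => rad_pos (rad_im (mu_ n))) &
      locally_bounded (fun n => rad_neg (rad_im (mu_ n)))].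

Lemma radon_locally_bounded_comp (mu_ : nat -> radon R) (s : nat -> nat) :
  s n @[n --> \oo] --> \oo -> radon_locally_bounded mu_ ->
  radon_locally_bounded (mu_ \o s).
Proof.
by move=> soo [b1 b2 b3 b4]; split;
  [exact: (locally_bounded_comp soo b1)|exact: (locally_bounded_comp soo b2)
  |exact: (locally_bounded_comp soo b3)|exact: (locally_bounded_comp soo b4)].
Qed.

Lemma wide_cvg_comp (mu_ : nat -> radon R) nu (s : nat -> nat) :
  s n @[n --> \oo] --> \oo -> wide_cvg mu_ nu -> wide_cvg (mu_ \o s) nu.
Proof. by move=> soo cv f tf; exact: (cvg_comp _ _ soo (cv f tf)). Qed.

Lemma radon_selection (mu_ : nat -> radon R) : radon_locally_bounded mu_ ->
  exists (s : nat -> nat) nu,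
    s n @[n --> \oo] --> \oo /\ wide_cvg (mu_ \o s) nu.
Proof.
move=> [b1 b2 b3 b4].
have [s1 [l1 [s1oo cv1]]] := real_selection b1 b2.
have [s2 [l2 [s2oo cv2]]] := real_selection (locally_bounded_comp s1oo b3) (locally_bounded_comp s1oo b4).
exists (s1 \o s2), (Radon l1 l2); split; first exact: (cvg_comp _ _ s2oo s1oo).
apply/wide_cvgP; split => //=.
exact: (real_wide_cvg_comp s2oo cv1).
Qed.

End complex_wide.

(** * Integrals against dilated and restricted measures *)

Section change_of_measure.
Context {R : realType}.
Implicit Types (p : pos_radon R) (f : R -> R) (D : set R).

Lemma Rintegral_concentrated p D f : bounded_compact f -> measurable D ->
  D `<=` `]0, +oo[ -> p (`]0, +oo[ `\` D) = 0%E ->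
  Rintegral p `]0, +oo[ f = Rintegral p D f.
Proof.
move=> bf mD Dp p0; rewrite /Rintegral.
rewrite (@negligible_integral _ _ _ p `]0, +oo[ (`]0, +oo[ `\` D) (EFin \o f))//.
- by rewrite setDD setIidr.
- exact: measurableD.
- exact: bounded_compact_integrable.
Qed.

Lemma Rintegral_restr D (mD : measurable D) p f : bounded_compact f ->
  D `<=` `]0, +oo[ ->
  Rintegral (pos_radon_restr mD p) `]0, +oo[ f = Rintegral p D f.
Proof.
move=> bf Dp; rewrite (@Rintegral_concentrated _ D)//.
  congr fine; apply: eq_measure_integral => A mA AD.
  by rewrite /= /mrestr setIidl.
by rewrite /= /mrestr setDE -setIA setICl setI0 measure0.
Qed.

Lemma bounded_compact_scale f (t : R) : 0 < t -> bounded_compact f ->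
  bounded_compact (fun s => f (s / t)).
Proof.
move=> t0 [mf [c [d [B [c0 fB fcd]]]]]; split.
  have -> : (fun s => f (s / t)) = f \o (fun s => s / t) by [].
  apply: (measurable_comp _ _ mf) => //.
    move=> _ [s + <-]; rewrite /= !in_itv/= !andbT => s0.
    by rewrite divr_gt0.
  exact: mulrr_measurable.
exists (c * t), (d * t), B; split; first by rewrite mulr_gt0.
- by move=> s s0; apply: fB; rewrite divr_gt0.
- by move=> s s0 /fcd; rewrite divr_gt0// ler_pdivlMr// ler_pdivrMr//; apply.
Qed.

Lemma bounded_compact_pos f : bounded_compact f -> bounded_compact (f^\+).
Proof.
move=> [mf [c [d [B [c0 fB fcd]]]]]; split; first exact: measurable_funrpos.
exists c, d, B; split => // t t0.
- apply: le_trans (fB t t0); rewrite /funrpos ger0_norm ?le_max ?lexx ?orbT//.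
  by rewrite ge_max ler_norm normr_ge0.
- move=> ft; apply: fcd => //; apply: contra_neq ft => ft.
  by rewrite /funrpos ft maxxx.
Qed.

Lemma bounded_compact_opp f : bounded_compact f -> bounded_compact (\- f).
Proof.
move=> [mf [c [d [B [c0 fB fcd]]]]]; split; first exact: measurable_funN.
exists c, d, B; split => // t t0; first by rewrite normrN fB.
by rewrite oppr_eq0; exact: fcd.
Qed.

Lemma Rintegral_posneg p f : bounded_compact f ->
  Rintegral p `]0, +oo[ f =
  Rintegral p `]0, +oo[ f^\+ - Rintegral p `]0, +oo[ ((\- f)^\+).
Proof.
move=> bf; rewrite -RintegralB//; last 2 first.
- by apply: bounded_compact_integrable => //; exact: bounded_compact_pos.
- by apply: bounded_compact_integrable => //; exact/bounded_compact_pos/bounded_compact_opp.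
apply: eq_Rintegral => t _; rewrite /funrpos.
have [h|h] := leP (f t) 0.
  by rewrite max_l ?oppr_ge0// sub0r opprK.
by rewrite max_r ?oppr_le0 ?(ltW h)// subr0.
Qed.

Lemma Rintegral_dil rho (t : {posnum R}) p f : bounded_compact f ->
  Rintegral (pos_radon_dil rho t p) `]0, +oo[ f =
  (Vfun rho t%:num)^-1 * Rintegral p `]0, +oo[ (fun s => f (s / t%:num)).
Proof.
pose D : set R := `]0, +oo[%classic.
have mD : measurable D by exact: measurable_itv.
have preD : shrink t @^-1` D = D.
  by apply/seteqP; split => s; rewrite /D /shrink /= !in_itv/= !andbT pmulr_lgt0.
have ge0 g : bounded_compact g -> (forall s, 0 <= g s) ->
    Rintegral (pos_radon_dil rho t p) D g =
    (Vfun rho t%:num)^-1 * Rintegral p D (fun s => g (s / t%:num)).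
  move=> bg g0; rewrite /Rintegral.
  have mg : measurable_fun D (EFin \o g) by apply/measurable_EFinP; exact: bg.1.
  have -> : (\int[pos_radon_dil rho t p]_(s in D) (g s)%:E =
      ((Vfun rho t%:num)^-1)%:E * \int[dilated t p]_(s in D) (g s)%:E)%E.
    have := @ge0_integral_mscale _ _ _ (dilated t p) D mD
      (NngNum (Vfun_inv_ge0 rho t%:num)) (EFin \o g) mg.
    by apply => s _; rewrite lee_fin.
  have -> : (\int[dilated t p]_(s in D) (g s)%:E = \int[p]_(s in D) (g (s / t%:num))%:E)%E.
    have H := @ge0_integral_pushforward _ _ _ _ _ _ (measurable_shrink t) p D (EFin \o g) mD mg.
    rewrite -[in RHS]preD; apply: etrans (H _); last by move=> y _; rewrite lee_fin.
    by apply: eq_measure_integral => [|A mA _ //]; exact: measurable_shrink.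
  rewrite fineM//; apply: integrable_fin_num => //.
  by apply: bounded_compact_integrable => //; exact: bounded_compact_scale.
move=> bf.
have bp := bounded_compact_pos bf.
have bn := bounded_compact_pos (bounded_compact_opp bf).
have pos (g : R -> R) (s : R) : 0 <= g^\+ s by rewrite /funrpos le_max lexx orbT.
rewrite (Rintegral_posneg (pos_radon_dil rho t p) bf) (ge0 _ bp (pos _)) (ge0 _ bn (pos _)).
have t0 : 0 < t%:num by [].
by rewrite -mulrBr (Rintegral_posneg p (bounded_compact_scale t0 bf)).
Qed.

End change_of_measure.

(** * Splitting a kernel at its jump *)

Section cut.
Context {R : realType}.
Variables (k kt : R -> R) (a b : R).
Hypotheses (a0 : 0 < a)
  (ksupp : forall t : R, 0 < t -> k t != 0 -> a <= t <= b)
  (kcont : forall t : R, 0 < t -> t != 1 -> {for t, continuous k})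
  (kleft : k t @[t --> (1 : R)^'-] --> k 1)
  (kright : k t @[t --> (1 : R)^'+] --> kt 1)
  (ktE : forall t : R, t != 1 -> kt t = k t).

(** Beyond 1 the function [k] is frozen at its value [k 1], which is its left
    limit, and then brought down to 0 linearly between 1 and 2; symmetrically,
    [right_cut] freezes below 1 and vanishes below 1/2. *)
Definition left_cut (t : R) : R := k (Order.min t 1) * clamp (2 - t).
Definition right_cut (t : R) : R := kt (Order.max t 1) * clamp (2 * t - 1).

Lemma left_cutE t : t <= 1 -> left_cut t = k t.
Proof.
by move=> t1; rewrite /left_cut (min_idPl t1) clamp1 ?mulr1//; lra.
Qed.

Lemma right_cutE t : 1 <= t -> right_cut t = kt t.
Proof.
by move=> t1; rewrite /right_cut (max_idPl t1) clamp1 ?mulr1//; lra.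
Qed.

Lemma real_test_left_cut : real_test left_cut.
Proof.
split.
  move=> t t0; have cc : {for t, continuous (fun t : R => clamp (2 - t))}.
    apply: continuous_comp; last exact: continuous_clamp.
    by apply: cvgB; [exact: cvg_cst|exact: cvg_id].
  apply: cvgM; last exact: cc.
  have [t1|t1|->] := ltgtP t 1.
  - apply: cvg_trans (kcont t0 (negbT (lt_eqF t1))).
    apply: near_eq_cvg; near=> s.
    have s1 : s < 1 by near: s; exact: lt_nbhsl.
    by rewrite (min_l (ltW s1)).
  - apply: cvg_near_cst; near=> s.
    have s1 : 1 < s by near: s; exact: lt_nbhsr.
    by rewrite (min_r (ltW s1)).
  - have := (left_right_continuousP (fun s => k (Order.min s 1)) (1 : R)).1.
    rewrite minxx; apply; split.
      apply: cvg_trans kleft; apply: near_eq_cvg; near=> s.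
      have s1 : s < 1 by near: s; exact: nbhs_left_lt.
      by rewrite (min_l (ltW s1)).
    apply: cvg_near_cst; near=> s.
    have s1 : 1 < s by near: s; exact: nbhs_right_gt.
    by rewrite (min_r (ltW s1)).
exists (Order.min a 1), 2; split; first by rewrite lt_min a0 ltr01.
move=> t t0; rewrite mulf_eq0 negb_or => /andP[kn cn].
have t2 : t < 2.
  by rewrite ltNge; apply: contra cn => t2; rewrite clamp0//; lra.
rewrite ge_min (ltW t2) andbT.
move: kn; have [t1|t1] := leP t 1; last by rewrite (ltW t1) orbT.
by move=> kn; have /andP[-> _] := ksupp t0 kn.
Unshelve. all: by end_near. Qed.

Lemma real_test_right_cut : real_test right_cut.
Proof.
split.
  move=> t t0; have cc : {for t, continuous (fun t : R => clamp (2 * t - 1))}.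
    apply: continuous_comp; last exact: continuous_clamp.
    by apply: cvgB; [apply: cvgM; [exact: cvg_cst|exact: cvg_id]|exact: cvg_cst].
  apply: cvgM; last exact: cc.
  have [t1|t1|->] := ltgtP t 1.
  - apply: cvg_near_cst; near=> s.
    have s1 : s < 1 by near: s; exact: lt_nbhsl.
    by rewrite (max_r (ltW s1)).
  - rewrite ktE ?gt_eqF//; apply: cvg_trans (kcont t0 (negbT (gt_eqF t1))).
    apply: near_eq_cvg; near=> s.
    have s1 : 1 < s by near: s; exact: lt_nbhsr.
    by rewrite (max_l (ltW s1)) ktE// gt_eqF.
  - have := (left_right_continuousP (fun s => kt (Order.max s 1)) (1 : R)).1.
    rewrite maxxx; apply; split.
      apply: cvg_near_cst; near=> s.
      have s1 : s < 1 by near: s; exact: nbhs_left_lt.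
      by rewrite (max_r (ltW s1)).
    apply: cvg_trans kright; apply: near_eq_cvg; near=> s.
    have s1 : 1 < s by near: s; exact: nbhs_right_gt.
    by rewrite (max_l (ltW s1)) ktE// gt_eqF.
exists (2^-1), (Order.max b 1); split; first by rewrite invr_gt0.
move=> t t0; rewrite mulf_eq0 negb_or => /andP[kn cn].
have -> : 2^-1 <= t.
  rewrite leNgt; apply: contra cn => t2; rewrite clamp0//; lra.
rewrite le_max; move: kn; have [t1|t1] := leP t 1; first by rewrite orbT.
rewrite (ktE (negbT (gt_eqF t1))) => kn; have /andP[_ ->] := ksupp t0 kn.
by [].
Unshelve. all: by end_near. Qed.

Lemma bounded_compact_kernel : bounded_compact k.
Proof.
have [_ [c1 [d1 [B1 [c10 B1P f1]]]]] := real_test_bounded_compact real_test_left_cut.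
have [_ [c2 [d2 [B2 [c20 B2P f2]]]]] := real_test_bounded_compact real_test_right_cut.
have [ml _] := real_test_bounded_compact real_test_left_cut.
have [mr _] := real_test_bounded_compact real_test_right_cut.
split.
  have -> : `]0, +oo[%classic = `]0, 1] `|` `]1, +oo[ :> set R.
    by rewrite -itv_bndbnd_setU// bnd_simp.
  apply/measurable_funU => //; split.
    apply: (@eq_measurable_fun _ _ _ _ _ left_cut).
      by move=> t; rewrite inE/= in_itv/= => /andP[_ /left_cutE].
    by apply: measurable_funS ml => // t /=; rewrite !in_itv/= => /andP[->].
  apply: (@eq_measurable_fun _ _ _ _ _ right_cut).
    move=> t; rewrite inE/= in_itv/= andbT => t1.
    by rewrite right_cutE ?ktE ?gt_eqF// ltW.
  by apply: measurable_funS mr => // t /=; rewrite !in_itv/= !andbT; exact: lt_trans.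
exists a, b, (Order.max B1 B2); split => // t t0.
have [t1|t1] := leP t 1; first by rewrite -(left_cutE t1) le_max B1P.
have n1 : t != 1 by rewrite gt_eqF.
by rewrite -(ktE n1) -(right_cutE (ltW t1)) le_max B2P// orbT.
Qed.

End cut.

(** * Limits of restricted measures *)

Section restricted_limits.
Context {R : realType}.

Lemma itv01_pos : `]0, 1]%classic `<=` (`]0, +oo[%classic : set R).
Proof. by move=> t /=; rewrite !in_itv/= => /andP[->]. Qed.

Lemma itv1y_pos : `]1, +oo[%classic `<=` (`]0, +oo[%classic : set R).
Proof. by move=> t /=; rewrite !in_itv/= !andbT; exact: lt_trans. Qed.

(** A test function supported in ]c, d'[ does not see measures restricted to [D],
    hence has integral 0 against their limit. The margin between [d] and [d'] is
    room for the falling ramps of trapezoids. *)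
Lemma restricted_limit_null (D : set R) (mD : measurable D)
    (m_ : nat -> real_radon R) (l : real_radon R) (c d d' : R) :
  D `<=` `]0, +oo[ -> 0 < c -> d < d' -> (forall t, D t -> ~ (c < t < d')) ->
  real_wide_cvg (fun n => real_radon_restr mD (m_ n)) l ->
  rad_pos l `]c, d]%classic = 0%E /\ rad_neg l `]c, d]%classic = 0%E.
Proof.
move=> Dp c0 dd' Dcd cv; apply: (null_oc_of_test c0 dd') => f tf fcd.
have bf := real_test_bounded_compact tf.
have f0 (p : pos_radon R) : Rintegral p D f = 0.
  transitivity (Rintegral p D (fun=> 0)); last by rewrite Rintegral_cst// mul0r.
  apply: eq_Rintegral => t; rewrite inE => Dt.
  have t0 : 0 < t by have := Dp _ Dt; rewrite /= in_itv/= andbT.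
  by apply/eqP; apply: contraT => /(fcd t t0)/(Dcd t Dt).
have := cv f tf; rewrite /signed_int.
under eq_fun do rewrite !Rintegral_restr// !f0 subrr.
move=> /cvg_unique; apply => //; exact: cvg_cst.
Qed.

Lemma null_bigcup (p : pos_radon R) (E : set R) (F : nat -> set R) :
  measurable E -> (forall n, measurable (F n)) -> (forall n, p (F n) = 0%E) ->
  E `<=` \bigcup_n F n -> p E = 0%E.
Proof.
move=> mE mF F0 EF; apply/eqP; rewrite -measure_le0.
apply: le_trans (measure_sigma_subadditive p mF mE EF) _.
by rewrite eseries0.
Qed.

(** The limit may acquire mass at the point 1 but not beyond it. *)
Lemma left_limit_signed_int (m_ : nat -> real_radon R) (l : real_radon R) (k phi : R -> R) :
  real_wide_cvg (fun n => real_radon_restr (measurable_itv `]0, 1]) (m_ n)) l ->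
  real_test phi -> (forall t, t <= 1 -> phi t = k t) ->
  signed_int l `]0, +oo[ phi = signed_int l `]0, 1] k.
Proof.
move=> cv tphi phik.
pose F (n : nat) : set R := `]1, n%:R]%classic.
have F0 n : rad_pos l (F n) = 0%E /\ rad_neg l (F n) = 0%E.
  apply: (@restricted_limit_null _ _ m_ l 1 n%:R (n%:R + 1) itv01_pos ltr01 _ _ cv).
    by rewrite ltrDl.
  by move=> t /=; rewrite in_itv/= => /andP[_ t1] /andP[]; rewrite ltNge t1.
have E0 (p : pos_radon R) : (forall n, p (F n) = 0%E) -> p (`]0, +oo[ `\` `]0, 1]) = 0%E.
  move=> pF; have mF n : measurable (F n) by exact: measurable_itv.
  apply: (null_bigcup _ mF pF); first by apply: measurableD.
  move=> t [/=]; rewrite !in_itv/= andbT => -> /= /negP; rewrite -ltNge => t1.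
  have /filter_ex[n tn] : \forall n \near \oo, t < n%:R := nbhs_infty_gtr _.
  by exists n => //; rewrite /F /= in_itv/= t1 ltW.
have H (p : pos_radon R) : (forall n, p (F n) = 0%E) ->
    Rintegral p `]0, +oo[ phi = Rintegral p `]0, 1] k.
  move=> pF; rewrite (@Rintegral_concentrated _ p `]0, 1])//.
  - by apply: eq_Rintegral => t; rewrite inE/= in_itv/= => /andP[_ /phik].
  - exact: real_test_bounded_compact.
  - exact: itv01_pos.
  - exact: E0.
by rewrite /signed_int (H _ (fun n => (F0 n).1)) (H _ (fun n => (F0 n).2)).
Qed.

(** Mass of the restrictions to the open half-line may accumulate at 1, whence the
    closed half-line in the conclusion. *)
Lemma right_limit_signed_int (m_ : nat -> real_radon R) (l : real_radon R) (k phi : R -> R) :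
  real_wide_cvg (fun n => real_radon_restr (measurable_itv `]1, +oo[) (m_ n)) l ->
  real_test phi -> (forall t, 1 <= t -> phi t = k t) ->
  signed_int l `]0, +oo[ phi = signed_int l `[1, +oo[ k.
Proof.
move=> cv tphi phik.
pose F (n : nat) : set R := `]n.+2%:R^-1, 1 - n.+2%:R^-1]%classic.
have i0 n : 0 < n.+2%:R^-1 :> R by rewrite invr_gt0.
have F0 n : rad_pos l (F n) = 0%E /\ rad_neg l (F n) = 0%E.
  apply: (@restricted_limit_null _ _ m_ l _ _ 1 itv1y_pos (i0 n) _ _ cv).
    by rewrite ltrBlDr ltrDl.
  by move=> t /=; rewrite in_itv/= andbT => t1 /andP[_]; rewrite ltNge ltW.
have E0 (p : pos_radon R) : (forall n, p (F n) = 0%E) -> p (`]0, +oo[ `\` `[1, +oo[) = 0%E.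
  move=> pF; have mF n : measurable (F n) by exact: measurable_itv.
  apply: (null_bigcup _ mF pF); first by apply: measurableD.
  move=> t [/=]; rewrite !in_itv/= !andbT => t0 /negP; rewrite -ltNge => t1.
  have m0 : 0 < Order.min t (1 - t) by rewrite lt_min t0 subr_gt0.
  have /filter_ex[n] : \forall n \near \oo, n.+1%:R^-1 < Order.min t (1 - t) := near_infty_natSinv_lt (PosNum m0).
  rewrite lt_min => /andP[tn tn'].
  have le : n.+2%:R^-1 <= n.+1%:R^-1 :> R by rewrite lef_pV2 ?posrE// ler_nat.
  exists n => //; rewrite /F /= in_itv/=.
  move: (n.+2%:R^-1) (n.+1%:R^-1) le tn tn' => x y xy yt yt'.
  by apply/andP; split; lra.
have H (p : pos_radon R) : (forall n, p (F n) = 0%E) ->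
    Rintegral p `]0, +oo[ phi = Rintegral p `[1, +oo[ k.
  move=> pF; rewrite (@Rintegral_concentrated _ p `[1, +oo[)//.
  - by apply: eq_Rintegral => t; rewrite inE/= in_itv/= andbT => /phik.
  - exact: real_test_bounded_compact.
  - by move=> t /=; rewrite !in_itv/= !andbT; exact: lt_le_trans.
  - exact: E0.
by rewrite /signed_int (H _ (fun n => (F0 n).1)) (H _ (fun n => (F0 n).2)).
Qed.

(** Dilation carries the kernel [k (s / t)] back to [k]; the jump is then
    harmless, since each half of [k] is integrated only where it coincides with a
    continuous function. *)
Lemma signed_int_split (rho : R -> R) (t : {posnum R}) (m : real_radon R)
    (k phi1 phi2 : R -> R) :
  bounded_compact k -> real_test phi1 -> real_test phi2 ->
  (forall s, s <= 1 -> phi1 s = k s) -> (forall s, 1 < s -> phi2 s = k s) ->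
  (Vfun rho t%:num)^-1 * signed_int m `]0, +oo[ (fun s => k (s / t%:num)) =
  signed_int (real_radon_restr (measurable_itv `]0, 1]) (real_radon_dil rho t m)) `]0, +oo[ phi1
  + signed_int (real_radon_restr (measurable_itv `]1, +oo[) (real_radon_dil rho t m)) `]0, +oo[ phi2.
Proof.
move=> bk t1 t2 k1 k2.
have b1 := real_test_bounded_compact t1; have b2 := real_test_bounded_compact t2.
have H (p : pos_radon R) :
    (Vfun rho t%:num)^-1 * Rintegral p `]0, +oo[ (fun s => k (s / t%:num)) =
    Rintegral (pos_radon_restr (measurable_itv `]0, 1]) (pos_radon_dil rho t p)) `]0, +oo[ phi1
    + Rintegral (pos_radon_restr (measurable_itv `]1, +oo[) (pos_radon_dil rho t p)) `]0, +oo[ phi2.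
  rewrite (Rintegral_restr _ _ b1 itv01_pos) (Rintegral_restr _ _ b2 itv1y_pos).
  rewrite -Rintegral_dil//.
  have U : `]0, +oo[%classic = `]0, 1]%classic `|` `]1, +oo[%classic :> set R.
    by rewrite -itv_bndbnd_setU// bnd_simp.
  rewrite U Rintegral_setU//; last 2 first.
  - by rewrite -U; exact: bounded_compact_integrable.
  - apply/disj_setPS => s [/=]; rewrite !in_itv/= andbT => /andP[_ s1].
    by rewrite ltNge s1.
  congr (_ + _); apply: eq_Rintegral => s; rewrite inE/= in_itv/=.
    by move=> /andP[_ /k1].
  by rewrite andbT => /k2.
rewrite /signed_int mulrBr !H /=; ring.
Qed.

End restricted_limits.

(** * The limit set of J *)

Section complex_plane.
Context {R : realType}.

Lemma cplx_hausdorff : hausdorff_space (cplx R).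
Proof. exact: norm_hausdorff. Qed.

(** Squares are compact neighbourhoods; they come from the real plane through a
    continuous map. *)
Lemma cplx_locally_compact : locally_compact [set: cplx R].
Proof.
move=> z _; rewrite withinET.
pose S : set (R * R) := `[complex.Re z - 1, complex.Re z + 1]%classic `*`
  `[complex.Im z - 1, complex.Im z + 1]%classic.
pose h (xy : R * R) : cplx R := (xy.1 +i* xy.2)%C.
have ch : continuous h.
  by move=> xy; apply: cvg_ReIm => /=; [exact: cvg_fst|exact: cvg_snd].
have cS : compact (h @` S).
  apply: continuous_compact; first exact: continuous_subspaceT.
  by apply: compact_setX; exact: segment_compact.
exists (h @` S); last by split => //; apply: compact_closed => //; exact: cplx_hausdorff.
apply/nbhs_ballP; exists 1 => //= w; rewrite /ball/=.
case: z @S cS => u v S cS; case: w => x y zw.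
have zw' : Normc.normc ((u - x) +i* (v - y))%C < 1.
  by move: zw; rewrite normC_real ltcR.
have hre := le_lt_trans (ler_normc_Re (u - x) (v - y)) zw'.
have him := le_lt_trans (ler_normc_Im (u - x) (v - y)) zw'.
move: hre him; rewrite !ltr_norml => /andP[? ?] /andP[? ?].
exists (x, y) => //; split; rewrite /= in_itv/=; apply/andP; split; lra.
Qed.

End complex_plane.

Lemma scale_complex_add (R : realType) (v x y z w x1 y1 z1 w1 x2 y2 z2 w2 : R) :
  v * x = x1 + x2 -> v * y = y1 + y2 -> v * z = z1 + z2 -> v * w = w1 + w2 ->
  ((x1 - y1) +i* (z1 + w1))%C + ((x2 - y2) +i* (z2 + w2))%C
  = (v%:C)%C * ((x - y) +i* (z + w))%C.
Proof.
move=> ex ey ez ew; apply/eqP; rewrite eq_complex /=.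
rewrite !mul0r subr0 addr0 mulrBr mulrDr ex ey ez ew.
by apply/andP; split; apply/eqP; ring.
Qed.

Section kernel.
Context {R : realType} (K : R -> cplx R) (a b : R).
Hypotheses (a0 : 0 < a) (Ksupp : fun_support K `<=` `[a, b])
  (Kcont : forall t : R, 0 < t -> t != 1 -> {for t, continuous K})
  (Kright : cvg (K t @[t --> (1 : R)^'+]))
  (Kleft : K t @[t --> (1 : R)^'-] --> K 1).

Let Kt := right_extension K 1.

Let KtE t : t != 1 -> Kt t = K t.
Proof. by move=> /negbTE t1; rewrite /Kt /right_extension t1. Qed.

Let Kt_right : K t @[t --> (1 : R)^'+] --> Kt 1.
Proof. rewrite /Kt /right_extension eqxx; exact: Kright. Qed.

Let Ksupp' t : 0 < t -> K t != 0 -> a <= t <= b.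
Proof.
move=> t0 Kt0; have : fun_support K t by apply: subset_closure.
by move=> /Ksupp /=; rewrite in_itv.
Qed.


(** Meant for [p] the real and the imaginary part. *)
Lemma coordinate_cuts (p : cplx R -> R) : p 0 = 0 ->
  (forall (f : R -> cplx R) (F : set_system R) (l : cplx R), Filter F ->
     f t @[t --> F] --> l -> p (f t) @[t --> F] --> p l) ->
  [/\ real_test (left_cut (p \o K)), real_test (right_cut (p \o Kt)) &
      bounded_compact (p \o K)].
Proof.
move=> p0 cp.
have supp t : 0 < t -> (p \o K) t != 0 -> a <= t <= b.
  by move=> t0 h; apply: Ksupp' => //; apply: contra_neq h => /= ->.
have cont t : 0 < t -> t != 1 -> {for t, continuous (p \o K)}.
  by move=> t0 t1; apply: cp; exact: Kcont.
have kl : (p \o K) t @[t --> (1 : R)^'-] --> (p \o K) 1.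
  exact: (cp K _ (K 1) _ Kleft).
have kr : (p \o K) t @[t --> (1 : R)^'+] --> (p \o Kt) 1.
  exact: (cp K _ (Kt 1) _ Kt_right).
have E t : t != 1 -> (p \o Kt) t = (p \o K) t by move=> t1; rewrite /= KtE.
split.
- exact: real_test_left_cut supp cont kl.
- exact: real_test_right_cut supp cont kr E.
- exact: bounded_compact_kernel supp cont kl kr E.
Qed.

(** Both inclusions of the theorem rest on this convergence: one provides the wide
    limits by definition of the extended limit set, the other by selection. *)
Lemma J_cvg (rho : R -> R) (mu : radon R) (r : nat -> {posnum R}) (nu1 nu2 : radon R) :
  wide_cvg (fun n => radon_restr (measurable_itv `]0, 1]) (radon_dil rho (r n) mu)) nu1 ->
  wide_cvg (fun n => radon_restr (measurable_itv `]1, +oo[) (radon_dil rho (r n) mu)) nu2 ->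
  (((Vfun rho (r n)%:num)^-1)%:C)%C *
     integral_radon mu `]0, +oo[ (fun t => K (t / (r n)%:num)) @[n --> \oo]
  --> integral_radon nu1 `]0, 1] K + integral_radon nu2 `[1, +oo[ Kt.
Proof.
move=> cv1 cv2.
have [lre rre bre] := @coordinate_cuts (@complex.Re R) erefl (fun f F l FF => @cvg_Re R _ F FF f l).
have [lim rim bim] := @coordinate_cuts (@complex.Im R) erefl (fun f F l FF => @cvg_Im R _ F FF f l).
pose phi1 (t : R) : cplx R := (left_cut (@complex.Re R \o K) t +i* left_cut (@complex.Im R \o K) t)%C.
pose phi2 (t : R) : cplx R := (right_cut (@complex.Re R \o Kt) t +i* right_cut (@complex.Im R \o Kt) t)%C.
have t1 : test_function phi1 by exact: test_function_of_ReIm.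
have t2 : test_function phi2 by exact: test_function_of_ReIm.
have [cv1re cv1im] := (wide_cvgP _ _).1 cv1.
have [cv2re cv2im] := (wide_cvgP _ _).1 cv2.
have -> : integral_radon nu1 `]0, 1] K = integral_radon nu1 `]0, +oo[ phi1.
  rewrite !integral_radonE /=.
  rewrite !(left_limit_signed_int cv1re lre (@left_cutE _ _))
    !(left_limit_signed_int cv1re lim (@left_cutE _ _)).
  by rewrite !(left_limit_signed_int cv1im lre (@left_cutE _ _))
    !(left_limit_signed_int cv1im lim (@left_cutE _ _)).
have -> : integral_radon nu2 `[1, +oo[ Kt = integral_radon nu2 `]0, +oo[ phi2.
  rewrite !integral_radonE /=.
  rewrite !(right_limit_signed_int cv2re rre (@right_cutE _ _))
    !(right_limit_signed_int cv2re rim (@right_cutE _ _)).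
  by rewrite !(right_limit_signed_int cv2im rre (@right_cutE _ _))
    !(right_limit_signed_int cv2im rim (@right_cutE _ _)).
apply: cvg_trans (cvgD (cv1 _ t1) (cv2 _ t2)).
apply: near_eq_cvg; apply: nearW => n /=.
have split_re m := @signed_int_split _ rho (r n) m _ _ _ bre lre rre (@left_cutE _ _).
have split_im m := @signed_int_split _ rho (r n) m _ _ _ bim lim rim (@left_cutE _ _).
have Er (s : R) : 1 < s -> right_cut (@complex.Re R \o Kt) s = (@complex.Re R \o K) s.
  by move=> s1; rewrite right_cutE ?(ltW s1)//= KtE// gt_eqF.
have Ei (s : R) : 1 < s -> right_cut (@complex.Im R \o Kt) s = (@complex.Im R \o K) s.
  by move=> s1; rewrite right_cutE ?(ltW s1)//= KtE// gt_eqF.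
transitivity (
  integral_radon (radon_restr (measurable_itv `]0, 1]) (radon_dil rho (r n) mu)) `]0, +oo[ phi1
  + integral_radon (radon_restr (measurable_itv `]1, +oo[) (radon_dil rho (r n) mu)) `]0, +oo[ phi2).
  by [].
rewrite !integral_radonE; apply: scale_complex_add.
- exact: split_re Er.
- exact: split_im Ei.
- exact: split_im Ei.
- exact: split_re Er.
Qed.

End kernel.

Theorem theorem4p2 (R : realType) (rho : R -> R) (mu : radon R)
    (K : R -> cplx R) (a b : R) :
  proximate_order rho ->
  M_infty rho mu ->
  0 < a -> a <= b -> fun_support K `<=` `[a, b] ->
  (forall t, 0 < t -> t != 1 -> {for t, continuous K}) ->
  first_kind_discontinuity K 1 ->
  K t @[t --> (1 : R)^'-] --> K 1 ->
  let J : R -> cplx R := fun r =>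
    (((Vfun rho r)^-1)%:C)%C * integral_radon mu `]0, +oo[ (fun t => K (t / r)) in
  limit_set J =
    Some @` [set integral_radon nu.1 `]0, 1] K
               + integral_radon nu.2 `[1, +oo[ (right_extension K 1)
            | nu in Fr_hat rho mu].
Proof.
move=> prho muM a0 ab Ksupp Kcont [_ Kright _] Kleft J.
apply/seteqP; split => [z [r roo Jz]|_ [_ [[nu1 nu2] [r roo [nu0 [_ cv1 cv2]]] <-] <-]]; last first.
  exists r => //.
  apply: continuous_cvg; first exact: one_point_compactification_some_continuous.
  exact: (J_cvg a0 Ksupp Kcont Kright Kleft cv1 cv2).
(* A limit value z of J along r: extract a subsequence along which the three
   families converge widely. *)
have [v1 v2 v3 v4] := M_infty_V_bounded muM.
have b0 : radon_locally_bounded (fun n => radon_dil rho (r n) mu).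
  by split; exact: dil_locally_bounded.
have restr_b (D : set R) (mD : measurable D) :
    radon_locally_bounded (fun n => radon_restr mD (radon_dil rho (r n) mu)).
  have H (p_ : nat -> pos_radon R) : locally_bounded p_ ->
      locally_bounded (fun n => pos_radon_restr mD (p_ n)).
    move=> b1 c d c0; have [M MP] := b1 c d c0; exists M; apply: filterS MP => n.
    by apply: le_trans; exact: restr_le.
  by case: b0 => h1 h2 h3 h4; split; exact: H.
have [s0 [nu0 [s0oo cv0]]] := radon_selection b0.
have [s1 [nu1 [s1oo cv1]]] := radon_selection
  (radon_locally_bounded_comp s0oo (restr_b _ (measurable_itv `]0, 1]))).
have s01oo : (s0 \o s1) n @[n --> \oo] --> \oo by exact: (cvg_comp _ _ s1oo s0oo).
have [s2 [nu2 [s2oo cv2]]] := radon_selection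
  (radon_locally_bounded_comp s01oo (restr_b _ (measurable_itv `]1, +oo[))).
pose s := s0 \o s1 \o s2.
have soo : s n @[n --> \oo] --> \oo by exact: (cvg_comp _ _ s2oo s01oo).
pose r' := r \o s.
have r'oo : (r' n)%:num @[n --> \oo] --> +oo by exact: (cvg_comp _ _ soo roo).
have cv1' := wide_cvg_comp s2oo cv1.
have cv0' := wide_cvg_comp (cvg_comp _ _ s2oo s1oo) cv0.
have Jv := J_cvg a0 Ksupp Kcont Kright Kleft cv1' cv2.
exists (integral_radon nu1 `]0, 1] K + integral_radon nu2 `[1, +oo[ (right_extension K 1)).
  exists (nu1, nu2); last by [].
  by exists r'; [exact: r'oo|exists nu0; split; [exact: cv0'|exact: cv1'|exact: cv2]].
have hd := one_point_compactification_hausdorff (@cplx_locally_compact R) (@cplx_hausdorff R).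
have JvS := cvg_comp _ _ Jv (@one_point_compactification_some_continuous (cplx R) _).
have Jzs := cvg_comp _ _ soo Jz.
exact: (cvg_unique hd JvS Jzs).
Qed.
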